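(* Let $\mathbb{H}=(\bar H=(H,e_H,m_H),\underline{H}=(H,\varepsilon_H,\delta_H))$ be a bialgebra in $\mathcal V$, let $\mathbb{A}=((A,\alpha_A),e_A,m_A)$ be a right $\mathbb{H}$-comodule algebra, and let $\lambda_{(A,\alpha_A)}:H\otimes A\to A\otimes H$ be the corresponding entwining structure. Suppose that $H$ is flat. Then the following are equivalent: (i) The functor $$\bar F:\mathcal V_{A^{\underline H}}\to\mathcal V_{\mathbb A}^{\underline H}(\lambda_{(A,\alpha_A)}),\qquad (X,\nu_X)\mapsto (X\otimes_{A^{\underline H}}A,\;X\otimes_{A^{\underline H}}m_A,\;X\otimes_{A^{\underline H}}\alpha_A)$$ is an equivalence of categories. (ii) $A$ is $\underline H$-Galois and ${}_{A^{\underline H}}A$ is faithfully flat.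
   Context: $\mathcal V=(V,\otimes,I)$ is a strict braided monoidal category with braiding $\sigma_{X,Y}:X\otimes Y\to Y\otimes X$, with equalizers and with coequalizers, and the tensor product preserves coequalizers in both variables. The name of an object also denotes its identity morphism. For an algebra (monoid) $B$ in $\mathcal V$, $\mathcal V_B$ is the category of right $B$-modules; $M\otimes_B N$ is the usual coequalizer. The tensor product of algebras $A,B$ is an algebra with $m_{A\otimes B}=(m_A\otimes m_B)(A\otimes\sigma_{B,A}\otimes B)$ and $e_{A\otimes B}=e_A\otimes e_B$. A bialgebra $\mathbb H$ is an object $H$ with an algebra structure $\bar H=(H,e_H,m_H)$ and a coalgebra structure $\underline H=(H,\varepsilon_H,\delta_H)$ such that $\varepsilon_H$ and $\delta_H$ are algebra morphisms. A right $\mathbb H$-comodule algebra is an algebra $(A,e_A,m_A)$ with a right $\underline H$-comodule structure $\alpha_A:A\to A\otimes H$ that is an algebra morphism from $A$ to $A\otimes\bar H$. The corresponding entwining structure is $\lambda_{(A,\alpha_A)}=(\varepsilon_H\otimes A\otimes H)\,\delta_{H\otimes A}:H\otimes A\to A\otimes H$, where $\delta_{H\otimes A}=(H\otimes A\otimes m_H)(H\otimes\sigma_{H,A}\otimes H)(\delta_H\otimes\alpha_A)$ is the tensor product comodule structure on $(H,\delta_H)\otimes(A,\alpha_A)$. For $\lambda:H\otimes A\to A\otimes H$, $\mathcal V^{\underline H}_{\mathbb A}(\lambda)$ is the category of triples $(X,\xi_X,\nu_X)$ with $(X,\xi_X:X\otimes A\to X)$ a right $A$-module, $(X,\nu_X:X\to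 X\otimes H)$ a right $\underline H$-comodule and $\nu_X\xi_X=(\xi_X\otimes H)(X\otimes\lambda)(\nu_X\otimes A)$; morphisms are morphisms of $\mathcal V$ that are both module and comodule morphisms. $i_A:A^{\underline H}\to A$ denotes the equalizer of $\alpha_A$ and $A\otimes e_H:A\to A\otimes H$; $A^{\underline H}$ carries an algebra structure making $i_A$ an algebra morphism, and $A$ is an $A^{\underline H}$-bimodule via $i_A$. $A$ is $\underline H$-Galois if the morphism $\mathrm{can}:A\otimes_{A^{\underline H}}A\to A\otimes H$ induced on the quotient by $(m_A\otimes H)(A\otimes\alpha_A):A\otimes A\to A\otimes H$ is an isomorphism. ''$H$ is flat'' means that $-\otimes H:\mathcal V\to\mathcal V$ preserves equalizers. ''${}_{A^{\underline H}}A$ is faithfully flat'' means that $-\otimes_{A^{\underline H}}A:\mathcal V_{A^{\underline H}}\to\mathcal V_A$ preserves equalizers and is conservative (reflects isomorphisms). *)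

(* Defs.v *)
From Corelib Require Import ssreflect.
From Stdlib Require Import ProofIrrelevance ClassicalEpsilon.

Set Implicit Arguments.
Unset Strict Implicit.
Unset Printing Implicit Defensive.

Declare Scope cat_scope.
Delimit Scope cat_scope with cat.
Local Open Scope cat_scope.

Record category := Category {
  ob :> Type;
  hom : ob -> ob -> Type;
  idm : forall X, hom X X;
  comp : forall X Y Z, hom Y Z -> hom X Y -> hom X Z;
  compf1 : forall X Y (f : hom X Y), comp f (idm X) = f;
  comp1f : forall X Y (f : hom X Y), comp (idm Y) f = f;
  compA : forall X Y Z T (h : hom Z T) (g : hom Y Z) (f : hom X Y),
    comp h (comp g f) = comp (comp h g) f }.

Arguments hom {c} X Y.
Arguments idm {c} X.
Arguments comp {c X Y Z} g f.
Arguments compf1 {c X Y} f.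
Arguments comp1f {c X Y} f.
Arguments compA {c X Y Z T} h g f.

Notation "g ∘ f" := (comp g f) (at level 50, left associativity) : cat_scope.

Definition is_iso (C : category) (X Y : C) (f : hom X Y) : Prop :=
  exists g : hom Y X, g ∘ f = idm X /\ f ∘ g = idm Y.

Definition is_equalizer (C : category) (X Y E : C) (f g : hom X Y)
    (e : hom E X) : Prop :=
  f ∘ e = g ∘ e /\
  forall (Z : C) (h : hom Z X), f ∘ h = g ∘ h -> exists! u : hom Z E, e ∘ u = h.

Definition is_coequalizer (C : category) (X Y Q : C) (f g : hom X Y)
    (q : hom Y Q) : Prop :=
  q ∘ f = q ∘ g /\
  forall (Z : C) (h : hom Y Z), h ∘ f = h ∘ g -> exists! u : hom Q Z, u ∘ q = h.

Record functor (C D : category) := Functor {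
  fob :> C -> D;
  fmap : forall X Y : C, hom X Y -> hom (fob X) (fob Y);
  fmap1 : forall X : C, fmap (idm X) = idm (fob X);
  fmap_comp : forall (X Y Z : C) (g : hom Y Z) (f : hom X Y),
    fmap (g ∘ f) = fmap g ∘ fmap f }.

Arguments fmap {C D} F {X Y} f : rename.

Definition id_functor (C : category) : functor C C :=
  @Functor C C (fun X => X) (fun _ _ f => f)
    (fun _ => eq_refl) (fun _ _ _ _ _ => eq_refl).

Lemma comp_functor_subproof1 (C D E : category) (G : functor D E)
  (F : functor C D) (X : C) : fmap G (fmap F (idm X)) = idm (G (F X)).
Proof. by rewrite !fmap1. Qed.

Lemma comp_functor_subproof2 (C D E : category) (G : functor D E)
  (F : functor C D) (X Y Z : C) (g : hom Y Z) (f : hom X Y) :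
  fmap G (fmap F (g ∘ f)) = fmap G (fmap F g) ∘ fmap G (fmap F f).
Proof. by rewrite !fmap_comp. Qed.

Definition comp_functor (C D E : category) (G : functor D E) (F : functor C D) :
    functor C E :=
  @Functor C E (fun X => G (F X)) (fun _ _ f => fmap G (fmap F f))
    (comp_functor_subproof1 G F) (comp_functor_subproof2 G F).

Definition nat_isomorphic (C D : category) (F G : functor C D) : Prop :=
  exists eta : forall X : C, hom (F X) (G X),
    (forall (X Y : C) (f : hom X Y), eta Y ∘ fmap F f = fmap G f ∘ eta X) /\
    (forall X : C, is_iso (eta X)).

Definition is_equivalence (C D : category) (F : functor C D) : Prop :=
  exists G : functor D C,
    nat_isomorphic (comp_functor G F) (id_functor C) /\
    nat_isomorphic (comp_functor F G) (id_functor D).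

Definition preserves_equalizers (C D : category) (F : functor C D) : Prop :=
  forall (X Y E : C) (f g : hom X Y) (e : hom E X),
    is_equalizer f g e -> is_equalizer (fmap F f) (fmap F g) (fmap F e).

Definition preserves_coequalizers (C D : category) (F : functor C D) : Prop :=
  forall (X Y Q : C) (f g : hom X Y) (q : hom Y Q),
    is_coequalizer f g q -> is_coequalizer (fmap F f) (fmap F g) (fmap F q).

Definition conservative (C D : category) (F : functor C D) : Prop :=
  forall (X Y : C) (f : hom X Y), is_iso (fmap F f) -> is_iso f.

(* In a strict monoidal category (X ⊗ Y) ⊗ Z and X ⊗ (Y ⊗ Z) are equal but not
   convertible, so equations between parallel morphisms "up to strictness" do
   not typecheck with [=].  [f ≈ g] says that f and g are equal as elements of
   the class of all arrows, i.e. that sources, targets and morphisms agree. *)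
Record arrow (C : category) := Arrow {
  src : C;
  tgt : C;
  arr : hom src tgt }.

Arguments Arrow {C src tgt} arr.

Notation "f ≈ g" := (Arrow f = Arrow g) (at level 70) : cat_scope.

Definition scomp (C : category) (X Y Y' Z : C) (g : hom Y' Z) (f : hom X Y)
    (e : Y = Y') : hom X Z :=
  g ∘ match e in _ = T return hom X T with eq_refl => f end.

Arguments scomp {C X Y Y' Z} g f e.

Record strict_monoidal := StrictMonoidal {
  mcat :> category;
  teno : mcat -> mcat -> mcat;
  unito : mcat;
  tenm : forall X X' Y Y' : mcat,
    hom X X' -> hom Y Y' -> hom (teno X Y) (teno X' Y');
  tenm1 : forall X Y : mcat, tenm (idm X) (idm Y) = idm (teno X Y);
  tenm_comp : forall (X X' X'' Y Y' Y'' : mcat)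
      (f' : hom X' X'') (f : hom X X') (g' : hom Y' Y'') (g : hom Y Y'),
    tenm (f' ∘ f) (g' ∘ g) = tenm f' g' ∘ tenm f g;
  tenoA : forall X Y Z : mcat, teno X (teno Y Z) = teno (teno X Y) Z;
  tenIo : forall X : mcat, teno unito X = X;
  tenoI : forall X : mcat, teno X unito = X;
  tenmA : forall (X X' Y Y' Z Z' : mcat)
      (f : hom X X') (g : hom Y Y') (h : hom Z Z'),
    tenm f (tenm g h) ≈ tenm (tenm f g) h;
  tenIm : forall (X X' : mcat) (f : hom X X'), tenm (idm unito) f ≈ f;
  tenmI : forall (X X' : mcat) (f : hom X X'), tenm f (idm unito) ≈ f }.

Arguments teno {s} X Y.
Arguments unito {s}.
Arguments tenm {s X X' Y Y'} f g.

Notation "X ⊗ Y" := (teno X Y) (at level 40, left associativity) : cat_scope.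
Notation "f ⊠ g" := (tenm f g) (at level 40, left associativity) : cat_scope.
Notation "'𝟙'" := unito : cat_scope.

Ltac strict_ob := by rewrite ?tenoA ?tenIo ?tenoI ?tenoA.

(* Composition of morphisms that are composable up to strictness; in particular
   [g ⊙ idm X] and [idm X ⊙ f] only adjust the source of g / the target of f. *)
Notation "g ⊙ f" := (scomp g f ltac:(strict_ob))
  (at level 50, left associativity, only parsing) : cat_scope.
Notation "g ⊙ f" := (scomp g f _)
  (at level 50, left associativity, only printing) : cat_scope.

Record braided := Braided {
  bcat :> strict_monoidal;
  braid : forall X Y : bcat, hom (X ⊗ Y) (Y ⊗ X);
  braid_iso : forall X Y : bcat, is_iso (braid X Y);
  braid_nat : forall (X X' Y Y' : bcat) (f : hom X X') (g : hom Y Y'),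
    braid X' Y' ∘ (f ⊠ g) = (g ⊠ f) ∘ braid X Y;
  braid_hexr : forall X Y Z : bcat,
    braid X (Y ⊗ Z) ≈ (idm Y ⊠ braid X Z) ⊙ (braid X Y ⊠ idm Z);
  braid_hexl : forall X Y Z : bcat,
    braid (X ⊗ Y) Z ≈ (braid X Z ⊠ idm Y) ⊙ (idm X ⊠ braid Y Z) }.

Notation σ := braid.

Lemma tensr_subproof1 (V : strict_monoidal) (Z X : V) :
  idm X ⊠ idm Z = idm (X ⊗ Z).
Proof. exact: tenm1. Qed.

Lemma tensr_subproof2 (V : strict_monoidal) (Z X X' X'' : V)
  (g : hom X' X'') (f : hom X X') :
  (g ∘ f) ⊠ idm Z = (g ⊠ idm Z) ∘ (f ⊠ idm Z).
Proof. by rewrite -tenm_comp compf1. Qed.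

Lemma tensl_subproof2 (V : strict_monoidal) (Z X X' X'' : V)
  (g : hom X' X'') (f : hom X X') :
  idm Z ⊠ (g ∘ f) = (idm Z ⊠ g) ∘ (idm Z ⊠ f).
Proof. by rewrite -tenm_comp compf1. Qed.

Definition tensr (V : strict_monoidal) (Z : V) : functor V V :=
  @Functor V V (fun X => X ⊗ Z) (fun _ _ f => f ⊠ idm Z)
    (tensr_subproof1 Z) (tensr_subproof2 Z).

Definition tensl (V : strict_monoidal) (Z : V) : functor V V :=
  @Functor V V (fun X => Z ⊗ X) (fun _ _ f => idm Z ⊠ f)
    (tenm1 Z) (tensl_subproof2 Z).

(* (Co)equalizers are chosen, so that the object of coinvariants and M ⊗_B N are
   given objects; the choice is arbitrary. *)
Record ambient := Ambient {
  acat :> braided;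
  eqo : forall X Y : acat, hom X Y -> hom X Y -> acat;
  eqm : forall (X Y : acat) (f g : hom X Y), hom (eqo f g) X;
  eqmP : forall (X Y : acat) (f g : hom X Y), is_equalizer f g (eqm f g);
  coeqo : forall X Y : acat, hom X Y -> hom X Y -> acat;
  coeqm : forall (X Y : acat) (f g : hom X Y), hom Y (coeqo f g);
  coeqmP : forall (X Y : acat) (f g : hom X Y), is_coequalizer f g (coeqm f g);
  tensr_coeq : forall Z : acat, preserves_coequalizers (tensr Z);
  tensl_coeq : forall Z : acat, preserves_coequalizers (tensl Z) }.

Arguments eqo {a X Y} f g.
Arguments eqm {a X Y} f g.
Arguments eqmP {a X Y} f g.
Arguments coeqo {a X Y} f g.
Arguments coeqm {a X Y} f g.
Arguments coeqmP {a X Y} f g.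

Definition flat (V : strict_monoidal) (Z : V) : Prop :=
  preserves_equalizers (tensr Z).

Record alg_data (V : strict_monoidal) := AlgData {
  alg_ob :> V;
  alg_unit : hom 𝟙 alg_ob;
  alg_mul : hom (alg_ob ⊗ alg_ob) alg_ob }.

Record is_algebra (V : strict_monoidal) (A : alg_data V) : Prop := IsAlgebra {
  alg_mulA : alg_mul A ∘ (alg_mul A ⊠ idm A) ≈ alg_mul A ∘ (idm A ⊠ alg_mul A);
  alg_mul1m : alg_mul A ∘ (alg_unit A ⊠ idm A) ≈ idm A;
  alg_mulm1 : alg_mul A ∘ (idm A ⊠ alg_unit A) ≈ idm A }.

Record algebra (V : strict_monoidal) := Algebra {
  alg_dataOf :> alg_data V;
  algP : is_algebra alg_dataOf }.

Definition is_alg_mor (V : strict_monoidal) (A B : alg_data V) (f : hom A B) :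
    Prop :=
  f ∘ alg_unit A = alg_unit B /\ f ∘ alg_mul A = alg_mul B ∘ (f ⊠ f).

Definition unit_alg (V : strict_monoidal) : alg_data V :=
  @AlgData V 𝟙 (idm 𝟙) (idm (𝟙 : V) ⊙ idm ((𝟙 : V) ⊗ 𝟙)).

Definition tens_alg (V : braided) (A B : alg_data V) : alg_data V :=
  @AlgData V (A ⊗ B)
    ((alg_unit A ⊠ alg_unit B) ⊙ idm (𝟙 : V))
    ((alg_mul A ⊠ alg_mul B) ⊙ (idm A ⊠ σ B A ⊠ idm B)
       ⊙ idm ((A ⊗ B) ⊗ (A ⊗ B))).

Record is_coalgebra (V : strict_monoidal) (C : V)
    (eps : hom C 𝟙) (delta : hom C (C ⊗ C)) : Prop := IsCoalgebra {
  coalg_comulA : (delta ⊠ idm C) ∘ delta ≈ (idm C ⊠ delta) ∘ delta;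
  coalg_comul1m : (eps ⊠ idm C) ∘ delta ≈ idm C;
  coalg_comulm1 : (idm C ⊠ eps) ∘ delta ≈ idm C }.

Record coalgebra (V : strict_monoidal) := Coalgebra {
  coalg_ob :> V;
  coalg_counit : hom coalg_ob 𝟙;
  coalg_comul : hom coalg_ob (coalg_ob ⊗ coalg_ob);
  coalgP : is_coalgebra coalg_counit coalg_comul }.

Record bialgebra (V : braided) := Bialgebra {
  bi_alg :> algebra V;
  bi_counit : hom bi_alg 𝟙;
  bi_comul : hom bi_alg (bi_alg ⊗ bi_alg);
  bi_coalgP : is_coalgebra bi_counit bi_comul;
  bi_counit_mor : @is_alg_mor V bi_alg (unit_alg V) bi_counit;
  bi_comul_mor : @is_alg_mor V bi_alg (tens_alg bi_alg bi_alg) bi_comul }.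

Definition bi_coalg (V : braided) (H : bialgebra V) : coalgebra V :=
  Coalgebra (bi_coalgP H).

Record is_rmod (V : strict_monoidal) (A : alg_data V) (X : V)
    (xi : hom (X ⊗ A) X) : Prop := IsRMod {
  rmod_actA : xi ∘ (xi ⊠ idm A) ≈ xi ∘ (idm X ⊠ alg_mul A);
  rmod_act1 : xi ∘ (idm X ⊠ alg_unit A) ≈ idm X }.

Record is_lmod (V : strict_monoidal) (A : alg_data V) (X : V)
    (xi : hom (A ⊗ X) X) : Prop := IsLMod {
  lmod_actA : xi ∘ (idm A ⊠ xi) ≈ xi ∘ (alg_mul A ⊠ idm X);
  lmod_act1 : xi ∘ (alg_unit A ⊠ idm X) ≈ idm X }.

Record is_rcomod (V : strict_monoidal) (C : coalgebra V) (X : V)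
    (nu : hom X (X ⊗ C)) : Prop := IsRComod {
  rcomod_coactA : (nu ⊠ idm C) ∘ nu ≈ (idm X ⊠ coalg_comul C) ∘ nu;
  rcomod_coact1 : (idm X ⊠ coalg_counit C) ∘ nu ≈ idm X }.

Record comod_algebra (V : braided) (H : bialgebra V) := ComodAlgebra {
  ca_alg :> algebra V;
  ca_coact : hom ca_alg (ca_alg ⊗ H);
  ca_comodP : is_rcomod (C := bi_coalg H) ca_coact;
  ca_mor : @is_alg_mor V ca_alg (tens_alg ca_alg H) ca_coact }.

Definition tens_coact (V : braided) (H : bialgebra V) (X Y : V)
    (nuX : hom X (X ⊗ H)) (nuY : hom Y (Y ⊗ H)) : hom (X ⊗ Y) (X ⊗ Y ⊗ H) :=
  (idm X ⊠ idm Y ⊠ alg_mul H) ⊙ (idm X ⊠ σ H Y ⊠ idm H) ⊙ (nuX ⊠ nuY).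

Definition entwining (V : braided) (H : bialgebra V) (A : comod_algebra H) :
    hom (H ⊗ A) (A ⊗ H) :=
  idm (A ⊗ H) ⊙ (bi_counit H ⊠ idm A ⊠ idm H)
    ⊙ tens_coact (bi_comul H) (ca_coact A).

Record rmod (V : strict_monoidal) (B : algebra V) := RMod {
  rmod_ob :> V;
  rmod_act : hom (rmod_ob ⊗ B) rmod_ob;
  rmodP : is_rmod rmod_act }.

Definition is_rmod_mor (V : strict_monoidal) (B : algebra V) (M N : rmod B)
    (f : hom M N) : Prop :=
  f ∘ rmod_act M = rmod_act N ∘ (f ⊠ idm B).

Lemma rmod_mor1 (V : strict_monoidal) (B : algebra V) (M : rmod B) :
  is_rmod_mor (M := M) (idm M).
Proof. by rewrite /is_rmod_mor tenm1 compf1 comp1f. Qed.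

Lemma rmod_mor_comp (V : strict_monoidal) (B : algebra V) (M N P : rmod B)
  (g : hom N P) (f : hom M N) :
  is_rmod_mor g -> is_rmod_mor f -> is_rmod_mor (g ∘ f).
Proof.
rewrite /is_rmod_mor => hg hf.
by rewrite tensr_subproof2 compA -hg -!compA hf.
Qed.

Lemma sig_eqP (T : Type) (P : T -> Prop) (u v : {x : T | P x}) :
  proj1_sig u = proj1_sig v -> u = v.
Proof. exact: eq_sig_hprop (fun x => @proof_irrelevance (P x)) u v. Qed.

Definition rmod_hom (V : strict_monoidal) (B : algebra V) (M N : rmod B) : Type :=
  {f : hom M N | is_rmod_mor f}.

Definition rmod_idm (V : strict_monoidal) (B : algebra V) (M : rmod B) :
    rmod_hom M M :=
  exist _ (idm M) (rmod_mor1 M).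

Definition rmod_comp (V : strict_monoidal) (B : algebra V) (M N P : rmod B)
    (g : rmod_hom N P) (f : rmod_hom M N) : rmod_hom M P :=
  exist _ (proj1_sig g ∘ proj1_sig f) (rmod_mor_comp (proj2_sig g) (proj2_sig f)).

Definition rmod_cat (V : strict_monoidal) (B : algebra V) : category.
Proof.
refine (@Category (rmod B) (@rmod_hom V B) (@rmod_idm V B) (@rmod_comp V B) _ _ _).
- by move=> M N f; apply: sig_eqP; exact: compf1.
- by move=> M N f; apply: sig_eqP; exact: comp1f.
- by move=> M N P Q h g f; apply: sig_eqP; exact: compA.
Defined.

Record entmod (V : strict_monoidal) (C : coalgebra V) (A : algebra V)
    (lambda : hom (C ⊗ A) (A ⊗ C)) := EntMod {
  entmod_ob :> V;
  entmod_act : hom (entmod_ob ⊗ A) entmod_ob;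
  entmod_coact : hom entmod_ob (entmod_ob ⊗ C);
  entmod_rmodP : is_rmod entmod_act;
  entmod_rcomodP : is_rcomod entmod_coact;
  entmod_compat : entmod_coact ∘ entmod_act
    = (entmod_act ⊠ idm C) ⊙ (idm entmod_ob ⊠ lambda) ⊙ (entmod_coact ⊠ idm A) }.

Definition is_entmod_mor (V : strict_monoidal) (C : coalgebra V) (A : algebra V)
    (lambda : hom (C ⊗ A) (A ⊗ C)) (X Y : entmod lambda) (f : hom X Y) : Prop :=
  f ∘ entmod_act X = entmod_act Y ∘ (f ⊠ idm A) /\
  entmod_coact Y ∘ f = (f ⊠ idm C) ∘ entmod_coact X.

Lemma entmod_mor1 (V : strict_monoidal) (C : coalgebra V) (A : algebra V)
  (lambda : hom (C ⊗ A) (A ⊗ C)) (X : entmod lambda) :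
  is_entmod_mor (X := X) (idm X).
Proof. by rewrite /is_entmod_mor !tenm1 !compf1 !comp1f. Qed.

Lemma entmod_mor_comp (V : strict_monoidal) (C : coalgebra V) (A : algebra V)
  (lambda : hom (C ⊗ A) (A ⊗ C)) (X Y Z : entmod lambda)
  (g : hom Y Z) (f : hom X Y) :
  is_entmod_mor g -> is_entmod_mor f -> is_entmod_mor (g ∘ f).
Proof.
move=> [hg kg] [hf kf]; split.
- by rewrite tensr_subproof2 compA -hg -!compA hf.
- by rewrite tensr_subproof2 compA kg -!compA kf.
Qed.

Definition entmod_hom (V : strict_monoidal) (C : coalgebra V) (A : algebra V)
    (lambda : hom (C ⊗ A) (A ⊗ C)) (X Y : entmod lambda) : Type :=
  {f : hom X Y | is_entmod_mor f}.

Definition entmod_idm (V : strict_monoidal) (C : coalgebra V) (A : algebra V)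
    (lambda : hom (C ⊗ A) (A ⊗ C)) (X : entmod lambda) : entmod_hom X X :=
  exist _ (idm X) (entmod_mor1 X).

Definition entmod_comp (V : strict_monoidal) (C : coalgebra V) (A : algebra V)
    (lambda : hom (C ⊗ A) (A ⊗ C)) (X Y Z : entmod lambda)
    (g : entmod_hom Y Z) (f : entmod_hom X Y) : entmod_hom X Z :=
  exist _ (proj1_sig g ∘ proj1_sig f)
    (entmod_mor_comp (proj2_sig g) (proj2_sig f)).

Definition entmod_cat (V : strict_monoidal) (C : coalgebra V) (A : algebra V)
    (lambda : hom (C ⊗ A) (A ⊗ C)) : category.
Proof.
refine (@Category (entmod lambda) (@entmod_hom V C A lambda)
  (@entmod_idm V C A lambda) (@entmod_comp V C A lambda) _ _ _).
- by move=> M N f; apply: sig_eqP; exact: compf1.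
- by move=> M N f; apply: sig_eqP; exact: comp1f.
- by move=> M N P Q h g f; apply: sig_eqP; exact: compA.
Defined.

(* Equational reasoning up to strictness.  A [parr] is a partial arrow: on these
   composition is total and, like ⊗, associative on the nose.  This serves only
   to check that the constructions below are well defined. *)

Record parr (C : category) := PArr {
  psrc : C;
  ptgt : C;
  pmor : option (hom psrc ptgt) }.

Definition pof (C : category) (X Y : C) (f : hom X Y) : parr C := PArr (Some f).

Arguments pof {C X Y} f.

Definition pcomp (C : category) (g f : parr C) : parr C :=
  @PArr C (psrc f) (ptgt g)
    match excluded_middle_informative (ptgt f = psrc g), pmor g, pmor f with
    | left e, Some g0, Some f0 => Some (scomp g0 f0 e)
    | _, _, _ => None
    end.

Definition pten (V : strict_monoidal) (f g : parr V) : parr V :=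
  @PArr V (psrc f ⊗ psrc g) (ptgt f ⊗ ptgt g)
    match pmor f, pmor g with
    | Some f0, Some g0 => Some (f0 ⊠ g0)
    | _, _ => None
    end.

Notation "⟦ f ⟧" := (pof f) (at level 0, format "⟦ f ⟧") : cat_scope.
Notation "g • f" := (pcomp g f) (at level 50, left associativity) : cat_scope.
Notation "f ⋆ g" := (pten f g) (at level 40, left associativity) : cat_scope.

Lemma pof_heq (C : category) (X Y X' Y' : C) (f : hom X Y) (g : hom X' Y') :
  ⟦f⟧ = ⟦g⟧ -> f ≈ g.
Proof.
move=> E.
pose F (p : parr C) := match pmor p with
  | Some h => Arrow h | None => Arrow (idm X) end.
exact: (f_equal F E).
Qed.

Lemma heq_pof (C : category) (X Y X' Y' : C) (f : hom X Y) (g : hom X' Y') :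
  f ≈ g -> ⟦f⟧ = ⟦g⟧.
Proof. exact: (f_equal (fun a => ⟦arr a⟧)). Qed.

Lemma heq_eq (C : category) (X Y : C) (f g : hom X Y) : f ≈ g -> f = g.
Proof.
move=> E.
have K (a b : arrow C) (ab : a = b) : forall (e1 : src a = src b)
    (e2 : tgt a = tgt b),
  eq_rect _ (fun T => hom T _) (eq_rect _ (hom _) (arr a) _ e2) _ e1 = arr b.
  by case: b / ab => e1 e2; rewrite (proof_irrelevance _ e1 eq_refl)
    (proof_irrelevance _ e2 eq_refl).
exact: (K _ _ E eq_refl eq_refl).
Qed.

Lemma pof_inj (C : category) (X Y : C) (f g : hom X Y) : ⟦f⟧ = ⟦g⟧ -> f = g.
Proof. by move=> /pof_heq /heq_eq. Qed.

Lemma pof_scomp (C : category) (X Y Y' Z : C) (g : hom Y' Z) (f : hom X Y)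
  (e : Y = Y') : ⟦scomp g f e⟧ = ⟦g⟧ • ⟦f⟧.
Proof.
rewrite /pof /pcomp /=; case: excluded_middle_informative => [e'|//].
by rewrite (proof_irrelevance _ e' e).
Qed.

Lemma pof_comp (C : category) (X Y Z : C) (g : hom Y Z) (f : hom X Y) :
  ⟦g ∘ f⟧ = ⟦g⟧ • ⟦f⟧.
Proof. by rewrite -(pof_scomp g f eq_refl). Qed.

Lemma pof_ten (V : strict_monoidal) (X X' Y Y' : V) (f : hom X X')
  (g : hom Y Y') : ⟦f ⊠ g⟧ = ⟦f⟧ ⋆ ⟦g⟧.
Proof. by []. Qed.

Lemma pof_id_ten (V : strict_monoidal) (X Y : V) :
  ⟦idm (X ⊗ Y)⟧ = ⟦idm X⟧ ⋆ ⟦idm Y⟧.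
Proof. by rewrite -pof_ten tenm1. Qed.

Lemma pcompA (C : category) (h g f : parr C) : h • (g • f) = h • g • f.
Proof.
case: f => [X Y f]; case: g => [Y' Z g]; case: h => [Z' T h].
rewrite /pcomp /=; congr PArr.
case: excluded_middle_informative => [e1|n1]; last first.
  case: excluded_middle_informative => [e2|n2]; last by [].
  by case: h g => [h|] [g|].
destruct e1; case: excluded_middle_informative => [e2|n2]; last by case: h g => [h|] [g|].
by destruct e2; case: h g f => [h|] [g|] [f|] //=; rewrite /scomp compA.
Qed.

Lemma pcomp1f (C : category) (X : C) (f : parr C) :
  ptgt f = X -> ⟦idm X⟧ • f = f.
Proof.
case: f => [Y Z f] /= e; destruct e; rewrite /pcomp /=; congr PArr.
case: excluded_middle_informative => [e|//].
rewrite (proof_irrelevance _ e eq_refl); case: f => [f|//].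
by rewrite /scomp comp1f.
Qed.

Lemma pcompf1 (C : category) (X : C) (f : parr C) :
  X = psrc f -> f • ⟦idm X⟧ = f.
Proof.
case: f => [Y Z f] /= e; destruct e; rewrite /pcomp /=; congr PArr.
case: excluded_middle_informative => [e|//].
rewrite (proof_irrelevance _ e eq_refl); case: f => [f|//].
by rewrite /scomp compf1.
Qed.

Lemma ptenC (V : strict_monoidal) (f f' g g' : parr V) :
  ptgt f = psrc f' -> ptgt g = psrc g' ->
  (f' ⋆ g') • (f ⋆ g) = (f' • f) ⋆ (g' • g).
Proof.
case: f f' g g' => [X Y f] [Y' Z f'] [T U g] [U' W g'] /= e1 e2.
destruct e1, e2; rewrite /pcomp /pten /=; congr PArr.
case: excluded_middle_informative => [e|//]; rewrite (proof_irrelevance _ e eq_refl).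
case: excluded_middle_informative => [e1|//]; rewrite (proof_irrelevance _ e1 eq_refl).
case: excluded_middle_informative => [e2|//]; rewrite (proof_irrelevance _ e2 eq_refl).
by case: f f' g g' => [f|] [f'|] [g|] [g'|] //=; rewrite /scomp tenm_comp.
Qed.

Lemma parr_None (C : category) (X X' Y Y' : C) : X = X' -> Y = Y' ->
  @PArr C X Y None = @PArr C X' Y' None.
Proof. by move=> e1 e2; destruct e1, e2. Qed.

Lemma ptenA (V : strict_monoidal) (f g h : parr V) :
  f ⋆ (g ⋆ h) = f ⋆ g ⋆ h.
Proof.
case: f g h => [X X' [f|]] [Y Y' [g|]] [Z Z' [h|]];
  try by apply: parr_None; rewrite /= tenoA.
exact: heq_pof (tenmA f g h).
Qed.

Lemma pten1f (V : strict_monoidal) (f : parr V) : ⟦idm 𝟙⟧ ⋆ f = f.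
Proof.
case: f => [X Y [f|]]; last by apply: parr_None; rewrite /= tenIo.
exact: heq_pof (tenIm f).
Qed.

Lemma ptenf1 (V : strict_monoidal) (f : parr V) : f ⋆ ⟦idm 𝟙⟧ = f.
Proof.
case: f => [X Y [f|]]; last by apply: parr_None; rewrite /= tenoI.
exact: heq_pof (tenmI f).
Qed.

Ltac obs := match goal with |- @eq (ob _) _ _ => solve [simpl; strict_ob] end.

Lemma ptenCl (V : strict_monoidal) (f f' : parr V) (X : V) :
  ptgt f = psrc f' ->
  (f' ⋆ ⟦idm X⟧) • (f ⋆ ⟦idm X⟧) = (f' • f) ⋆ ⟦idm X⟧.
Proof. by move=> e; rewrite ptenC // pcomp1f. Qed.

Lemma ptenCr (V : strict_monoidal) (f f' : parr V) (X : V) :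
  ptgt f = psrc f' ->
  (⟦idm X⟧ ⋆ f') • (⟦idm X⟧ ⋆ f) = ⟦idm X⟧ ⋆ (f' • f).
Proof. by move=> e; rewrite ptenC // pcomp1f. Qed.

Definition eq_lift (C : category) (X Y E : C) (f g : hom X Y) (e : hom E X)
    (P : is_equalizer f g e) (Z : C) (h : hom Z X) (fgh : f ∘ h = g ∘ h) :
    hom Z E :=
  proj1_sig (constructive_indefinite_description _ (proj2 P Z h fgh)).

Lemma eq_liftE (C : category) (X Y E : C) (f g : hom X Y) (e : hom E X)
  (P : is_equalizer f g e) (Z : C) (h : hom Z X) (fgh : f ∘ h = g ∘ h) :
  e ∘ eq_lift P fgh = h.
Proof.
rewrite /eq_lift; case: constructive_indefinite_description => u /= uP.
exact: (proj1 uP).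
Qed.

Lemma equalizer_mono (C : category) (X Y E : C) (f g : hom X Y) (e : hom E X)
  (P : is_equalizer f g e) (Z : C) (u v : hom Z E) : e ∘ u = e ∘ v -> u = v.
Proof.
move=> uv; have fgv : f ∘ (e ∘ v) = g ∘ (e ∘ v) by rewrite !compA (proj1 P).
have [w [_ w_uniq]] := proj2 P Z _ fgv.
by rewrite -(w_uniq u uv) -(w_uniq v).
Qed.

Definition coeq_desc (C : category) (X Y Q : C) (f g : hom X Y) (q : hom Y Q)
    (P : is_coequalizer f g q) (Z : C) (h : hom Y Z) (hfg : h ∘ f = h ∘ g) :
    hom Q Z :=
  proj1_sig (constructive_indefinite_description _ (proj2 P Z h hfg)).

Lemma coeq_descE (C : category) (X Y Q : C) (f g : hom X Y) (q : hom Y Q)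
  (P : is_coequalizer f g q) (Z : C) (h : hom Y Z) (hfg : h ∘ f = h ∘ g) :
  coeq_desc P hfg ∘ q = h.
Proof.
rewrite /coeq_desc; case: constructive_indefinite_description => u /= uP.
exact: (proj1 uP).
Qed.

Lemma coequalizer_epi (C : category) (X Y Q : C) (f g : hom X Y) (q : hom Y Q)
  (P : is_coequalizer f g q) (Z : C) (u v : hom Q Z) : u ∘ q = v ∘ q -> u = v.
Proof.
move=> uv; have vfg : (v ∘ q) ∘ f = (v ∘ q) ∘ g by rewrite -!compA (proj1 P).
have [w [_ w_uniq]] := proj2 P Z _ vfg.
by rewrite -(w_uniq u uv) -(w_uniq v).
Qed.

Lemma pbraid_nat (V : braided) (X X' Y Y' : V) (f : hom X X') (g : hom Y Y') :
  ⟦σ X' Y'⟧ • (⟦f⟧ ⋆ ⟦g⟧) = (⟦g⟧ ⋆ ⟦f⟧) • ⟦σ X Y⟧.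
Proof. by rewrite -!pof_ten -!pof_comp braid_nat. Qed.

Lemma pbraid1 (V : braided) (X : V) : ⟦σ 𝟙 X⟧ = ⟦idm X⟧.
Proof.
have [t [ts st]] := braid_iso (𝟙 : V) X.
have E : ⟦σ 𝟙 X⟧ • ⟦σ 𝟙 X⟧ = ⟦σ 𝟙 X⟧.
  have := heq_pof (braid_hexl (𝟙 : V) 𝟙 X).
  rewrite pof_scomp !pof_ten pten1f ptenf1 => <-.
  have EI := f_equal (fun Z : V => ⟦σ Z X⟧) (tenIo (𝟙 : V)); exact: EI.
have := f_equal (fun f => ⟦t⟧ • f) E.
rewrite /= pcompA -pof_comp ts pcomp1f; first by obs.
by move=> ->; rewrite pof_id_ten pten1f.
Qed.

(* The morphism A ⊗ e_H; the factor [idm A] identifies its source A ⊗ 𝟙 with A. *)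
Definition triv_coact (V : braided) (H : bialgebra V) (A : comod_algebra H) :
    hom A (A ⊗ H) :=
  (idm A ⊠ alg_unit H) ⊙ idm A.

Definition coinv_ob (V : ambient) (H : bialgebra V) (A : comod_algebra H) : V :=
  eqo (ca_coact A) (triv_coact A).

Definition coinv_i (V : ambient) (H : bialgebra V) (A : comod_algebra H) :
    hom (coinv_ob A) A :=
  eqm (ca_coact A) (triv_coact A).

Lemma ptriv_coact (V : braided) (H : bialgebra V) (A : comod_algebra H)
  (f : parr V) : ptgt f = A ->
  ⟦triv_coact A⟧ • f = f ⋆ ⟦alg_unit H⟧.
Proof.
move=> e; rewrite pof_scomp -pcompA pcomp1f // pof_ten.
rewrite -{1}[f]ptenf1 ptenC /= ?e //.
by rewrite pcomp1f // pcompf1.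
Qed.

Lemma pcoinv (V : ambient) (H : bialgebra V) (A : comod_algebra H) :
  ⟦ca_coact A⟧ • ⟦coinv_i A⟧ = ⟦coinv_i A⟧ ⋆ ⟦alg_unit H⟧.
Proof.
rewrite -pof_comp (proj1 (eqmP (ca_coact A) (triv_coact A))) pof_comp.
exact: ptriv_coact.
Qed.

Lemma pca_mul (V : braided) (H : bialgebra V) (A : comod_algebra H) :
  ⟦ca_coact A⟧ • ⟦alg_mul A⟧
  = (⟦alg_mul A⟧ ⋆ ⟦alg_mul H⟧) • (⟦idm A⟧ ⋆ ⟦σ H A⟧ ⋆ ⟦idm H⟧)
    • (⟦ca_coact A⟧ ⋆ ⟦ca_coact A⟧).
Proof.
rewrite -pof_comp (proj2 (ca_mor A)) pof_comp !pof_scomp !pof_ten.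
by rewrite [X in X • _]pcompf1 //; obs.
Qed.

Lemma pca_unit (V : braided) (H : bialgebra V) (A : comod_algebra H) :
  ⟦ca_coact A⟧ • ⟦alg_unit A⟧ = ⟦alg_unit A⟧ ⋆ ⟦alg_unit H⟧.
Proof.
rewrite -pof_comp (proj1 (ca_mor A)) /= pof_scomp pof_ten.
by rewrite pcompf1 //; obs.
Qed.

Lemma pmulA (V : strict_monoidal) (A : algebra V) :
  ⟦alg_mul A⟧ • (⟦alg_mul A⟧ ⋆ ⟦idm A⟧) = ⟦alg_mul A⟧ • (⟦idm A⟧ ⋆ ⟦alg_mul A⟧).
Proof. by rewrite -!pof_ten -!pof_comp; exact: heq_pof (alg_mulA (algP A)). Qed.

Lemma pmul1m (V : strict_monoidal) (A : algebra V) :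
  ⟦alg_mul A⟧ • (⟦alg_unit A⟧ ⋆ ⟦idm A⟧) = ⟦idm A⟧.
Proof. by rewrite -!pof_ten -!pof_comp; exact: heq_pof (alg_mul1m (algP A)). Qed.

Lemma pmulm1 (V : strict_monoidal) (A : algebra V) :
  ⟦alg_mul A⟧ • (⟦idm A⟧ ⋆ ⟦alg_unit A⟧) = ⟦idm A⟧.
Proof. by rewrite -!pof_ten -!pof_comp; exact: heq_pof (alg_mulm1 (algP A)). Qed.

Lemma pca_lin (V : ambient) (H : bialgebra V) (A : comod_algebra H) :
  ⟦ca_coact A⟧ • (⟦alg_mul A⟧ • (⟦coinv_i A⟧ ⋆ ⟦idm A⟧))
  = (⟦alg_mul A⟧ ⋆ ⟦idm H⟧) • (⟦coinv_i A⟧ ⋆ ⟦ca_coact A⟧).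
Proof.
rewrite pcompA pca_mul -!pcompA ptenC; try obs.
rewrite pcoinv pcompf1; try obs.
have -> : ⟦coinv_i A⟧ ⋆ ⟦alg_unit H⟧ ⋆ ⟦ca_coact A⟧
  = (⟦idm A⟧ ⋆ (⟦alg_unit H⟧ ⋆ ⟦idm A⟧) ⋆ ⟦idm H⟧) • (⟦coinv_i A⟧ ⋆ ⟦ca_coact A⟧).
  rewrite -[in RHS](pten1f ⟦ca_coact A⟧) !ptenA -!(ptenA _ ⟦idm A⟧ ⟦idm H⟧).
  rewrite -pof_id_ten ptenC /=; try obs.
  rewrite pcomp1f; try obs.
  congr (_ ⋆ _).
  rewrite -[X in _ = _ • X]ptenf1 ptenC; try obs.
  rewrite pcomp1f; try obs.
  by rewrite ptenf1 pcompf1.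
rewrite (pcompA _ _ (⟦coinv_i A⟧ ⋆ _)) ptenCl; try obs.
rewrite ptenCr; try obs.
rewrite pbraid_nat pbraid1 pcompf1; try obs.
rewrite pcompA; congr (_ • _).
rewrite ptenA -(ptenA _ ⟦alg_unit H⟧) -pof_id_ten ptenC; try obs.
rewrite pcompf1; try obs.
by rewrite pmul1m.
Qed.

Lemma pcoalg1m (V : strict_monoidal) (C : coalgebra V) :
  (⟦coalg_counit C⟧ ⋆ ⟦idm C⟧) • ⟦coalg_comul C⟧ = ⟦idm C⟧.
Proof.
by rewrite -!pof_ten -!pof_comp; exact: heq_pof (coalg_comul1m (coalgP C)).
Qed.

Lemma pentwining (V : braided) (H : bialgebra V) (A : comod_algebra H) :
  ⟦entwining A⟧
  = (⟦idm A⟧ ⋆ ⟦alg_mul H⟧) • (⟦σ H A⟧ ⋆ ⟦idm H⟧) • (⟦idm H⟧ ⋆ ⟦ca_coact A⟧).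
Proof.
rewrite !pof_scomp !pof_ten pcomp1f; try obs.
have -> : ⟦idm H⟧ ⋆ ⟦ca_coact A⟧ = (⟦bi_counit H⟧ ⋆ ⟦idm H⟧ ⋆ (⟦idm A⟧ ⋆ ⟦idm H⟧))
    • (⟦bi_comul H⟧ ⋆ ⟦ca_coact A⟧).
  rewrite ptenC; try obs.
  by rewrite (pcoalg1m (bi_coalg H)) -pof_id_ten pcomp1f.
rewrite !pcompA; congr (_ • _).
have -> : (⟦bi_counit H⟧ ⋆ ⟦idm A⟧ ⋆ ⟦idm H⟧) • (⟦idm H⟧ ⋆ ⟦idm A⟧ ⋆ ⟦alg_mul H⟧)
    = (⟦idm A⟧ ⋆ ⟦alg_mul H⟧) • (⟦bi_counit H⟧ ⋆ ⟦idm A⟧ ⋆ ⟦idm H⟧ ⋆ ⟦idm H⟧).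
  rewrite -!(ptenA _ ⟦idm H⟧) -pof_id_ten.
  rewrite [LHS]ptenC; try obs.
  rewrite [RHS]ptenC; try obs.
  rewrite -!pof_id_ten pcompf1; try obs.
  rewrite pcomp1f; try obs.
  rewrite pcomp1f; try obs.
  by rewrite pcompf1; try obs.
rewrite -!pcompA; congr (_ • _).
rewrite -!(ptenA _ ⟦idm H⟧) -!(ptenA _ ⟦idm A⟧) !ptenA.
rewrite [LHS]ptenCl; try obs.
rewrite -!(ptenA ⟦bi_counit H⟧) -[in RHS](pten1f ⟦σ H A⟧) -!pof_id_ten.
rewrite -!(ptenA _ _ ⟦idm H⟧).
rewrite ptenC; try obs.
rewrite [RHS]ptenC; try obs.
rewrite !pcompf1; try obs.
rewrite !pcomp1f; try obs.
by rewrite ptenA.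
Qed.

Lemma pca_entmod (V : braided) (H : bialgebra V) (A : comod_algebra H) :
  ⟦ca_coact A⟧ • ⟦alg_mul A⟧
  = (⟦alg_mul A⟧ ⋆ ⟦idm H⟧) • (⟦idm A⟧ ⋆ ⟦entwining A⟧)
    • (⟦ca_coact A⟧ ⋆ ⟦idm A⟧).
Proof.
rewrite pca_mul pentwining.
rewrite -!ptenCr; try obs.
rewrite !pcompA [in RHS]ptenA [in RHS]ptenC; try obs.
rewrite -pof_id_ten pcomp1f ?pcompf1; try obs.
rewrite -!pcompA ptenA; congr (_ • (_ • _)).
rewrite ptenA -pof_id_ten ptenC; try obs.
by rewrite pcomp1f ?pcompf1.
Qed.

Lemma coinv_unit_subproof (V : braided) (H : bialgebra V) (A : comod_algebra H) :
  ca_coact A ∘ alg_unit A = triv_coact A ∘ alg_unit A.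
Proof. by apply: pof_inj; rewrite [LHS]pof_comp [RHS]pof_comp pca_unit ptriv_coact. Qed.

Lemma coinv_mul_subproof (V : ambient) (H : bialgebra V) (A : comod_algebra H) :
  ca_coact A ∘ (alg_mul A ∘ (coinv_i A ⊠ coinv_i A))
  = triv_coact A ∘ (alg_mul A ∘ (coinv_i A ⊠ coinv_i A)).
Proof.
apply: pof_inj; rewrite [LHS]pof_comp [RHS]pof_comp pof_comp pof_ten.
rewrite ptriv_coact //.
have -> : ⟦coinv_i A⟧ ⋆ ⟦coinv_i A⟧
    = (⟦coinv_i A⟧ ⋆ ⟦idm A⟧) • (⟦idm (coinv_ob A)⟧ ⋆ ⟦coinv_i A⟧).
  by rewrite ptenC // pcompf1 // pcomp1f.
rewrite !pcompA -(pcompA _ _ (_ ⋆ ⟦idm A⟧)) pca_lin.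
rewrite -(pcompA _ _ (_ ⋆ ⟦coinv_i A⟧)) ptenC // pcoinv pcompf1 //.
rewrite ptenA ptenC; try obs.
rewrite pcomp1f //; congr (_ ⋆ _).
rewrite -pcompA; congr (_ • _).
by rewrite ptenC // pcompf1 // pcomp1f.
Qed.

Definition coinv_data (V : ambient) (H : bialgebra V) (A : comod_algebra H) :
    alg_data V :=
  @AlgData V (coinv_ob A)
    (eq_lift (eqmP (ca_coact A) (triv_coact A)) (coinv_unit_subproof A))
    (eq_lift (eqmP (ca_coact A) (triv_coact A)) (coinv_mul_subproof A)).

Lemma coinv_i_mor (V : ambient) (H : bialgebra V) (A : comod_algebra H) :
  is_alg_mor (A := coinv_data A) (coinv_i A).
Proof. by split; apply: eq_liftE. Qed.

Lemma pcoinv_unit (V : ambient) (H : bialgebra V) (A : comod_algebra H) :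
  ⟦coinv_i A⟧ • ⟦alg_unit (coinv_data A)⟧ = ⟦alg_unit A⟧.
Proof. by rewrite -pof_comp (proj1 (coinv_i_mor A)). Qed.

Lemma pcoinv_mul (V : ambient) (H : bialgebra V) (A : comod_algebra H) :
  ⟦coinv_i A⟧ • ⟦alg_mul (coinv_data A)⟧
  = ⟦alg_mul A⟧ • (⟦coinv_i A⟧ ⋆ ⟦coinv_i A⟧).
Proof. by rewrite -pof_comp (proj2 (coinv_i_mor A)) pof_comp. Qed.

Lemma pequalizer_mono (C : category) (X Y E : C) (f g : hom X Y) (e : hom E X)
  (P : is_equalizer f g e) (Z Z' T T' : C) (u : hom Z T) (v : hom Z' T') :
  Z = Z' -> T = E -> T' = E -> ⟦e⟧ • ⟦u⟧ = ⟦e⟧ • ⟦v⟧ -> ⟦u⟧ = ⟦v⟧.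
Proof.
move=> e1 e2 e3; destruct e1; subst T T'; rewrite -!pof_comp.
by move=> /pof_inj /(equalizer_mono P) ->.
Qed.

Lemma coinv_algP (V : ambient) (H : bialgebra V) (A : comod_algebra H) :
  is_algebra (coinv_data A).
Proof.
have mono := pequalizer_mono (eqmP (ca_coact A) (triv_coact A)).
split; apply: pof_heq; apply: mono => //; try obs.
- rewrite !pof_comp !pof_ten !pcompA !pcoinv_mul -!pcompA !ptenC //.
  rewrite !pcoinv_mul !pcompf1 //.
  have -> : ⟦coinv_i A⟧ ⋆ (⟦alg_mul A⟧ • ⟦coinv_i A⟧ ⋆ ⟦coinv_i A⟧)
    = (⟦idm A⟧ ⋆ ⟦alg_mul A⟧) • (⟦coinv_i A⟧ ⋆ (⟦coinv_i A⟧ ⋆ ⟦coinv_i A⟧)).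
    by rewrite ptenC // pcomp1f.
  have -> : (⟦alg_mul A⟧ • ⟦coinv_i A⟧ ⋆ ⟦coinv_i A⟧) ⋆ ⟦coinv_i A⟧
    = (⟦alg_mul A⟧ ⋆ ⟦idm A⟧) • (⟦coinv_i A⟧ ⋆ ⟦coinv_i A⟧ ⋆ ⟦coinv_i A⟧).
    by rewrite ptenC // pcomp1f.
  by rewrite !pcompA pmulA ptenA.
- rewrite pof_comp pof_ten pcompA pcoinv_mul -pcompA ptenC //.
  rewrite pcoinv_unit !pcompf1 //.
  have -> : ⟦alg_unit A⟧ ⋆ ⟦coinv_i A⟧ = (⟦alg_unit A⟧ ⋆ ⟦idm A⟧) • ⟦coinv_i A⟧.
    rewrite -[X in _ = _ • X]pten1f ptenC // pcomp1f //.
    by rewrite pcompf1.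
  by rewrite pcompA pmul1m pcomp1f.
- rewrite pof_comp pof_ten pcompA pcoinv_mul -pcompA ptenC //.
  rewrite pcoinv_unit !pcompf1 //.
  have -> : ⟦coinv_i A⟧ ⋆ ⟦alg_unit A⟧ = (⟦idm A⟧ ⋆ ⟦alg_unit A⟧) • ⟦coinv_i A⟧.
    rewrite -[X in _ = _ • X]ptenf1 ptenC // pcomp1f //.
    by rewrite pcompf1.
  by rewrite pcompA pmulm1 pcomp1f.
Qed.

Definition coinv (V : ambient) (H : bialgebra V) (A : comod_algebra H) :
    algebra V :=
  Algebra (coinv_algP A).

Record lmod (V : strict_monoidal) (B : algebra V) := LMod {
  lmod_ob :> V;
  lmod_act : hom (B ⊗ lmod_ob) lmod_ob;
  lmodP : is_lmod lmod_act }.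

Record bimod (V : strict_monoidal) (B A : algebra V) := Bimod {
  bimod_lmod :> lmod B;
  bimod_ract : hom (bimod_lmod ⊗ A) bimod_lmod;
  bimod_rmodP : is_rmod bimod_ract;
  bimodP : bimod_ract ∘ (lmod_act bimod_lmod ⊠ idm A)
    ≈ lmod_act bimod_lmod ∘ (idm B ⊠ bimod_ract) }.

Definition tensB_l (V : strict_monoidal) (B : algebra V) (M : rmod B)
    (N : lmod B) : hom (M ⊗ B ⊗ N) (M ⊗ N) :=
  rmod_act M ⊠ idm N.

Definition tensB_r (V : strict_monoidal) (B : algebra V) (M : rmod B)
    (N : lmod B) : hom (M ⊗ B ⊗ N) (M ⊗ N) :=
  (idm M ⊠ lmod_act N) ⊙ idm (M ⊗ B ⊗ N).

Definition tensB (V : ambient) (B : algebra V) (M : rmod B) (N : lmod B) : V :=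
  coeqo (tensB_l M N) (tensB_r M N).

Definition tensB_q (V : ambient) (B : algebra V) (M : rmod B) (N : lmod B) :
    hom (M ⊗ N) (tensB M N) :=
  coeqm (tensB_l M N) (tensB_r M N).

Definition tensB_desc (V : ambient) (B : algebra V) (M : rmod B) (N : lmod B)
    (W : V) (h : hom (M ⊗ N) W) (hP : h ∘ tensB_l M N = h ∘ tensB_r M N) :
    hom (tensB M N) W :=
  coeq_desc (coeqmP (tensB_l M N) (tensB_r M N)) hP.

(* Factorization through q ⊗ Z, which is a coequalizer too. *)
Definition tensB_descr (V : ambient) (B : algebra V) (M : rmod B) (N : lmod B)
    (Z W : V) (h : hom (M ⊗ N ⊗ Z) W)
    (hP : h ∘ (tensB_l M N ⊠ idm Z) = h ∘ (tensB_r M N ⊠ idm Z)) :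
    hom (tensB M N ⊗ Z) W :=
  coeq_desc (tensr_coeq Z (coeqmP (tensB_l M N) (tensB_r M N))) hP.

Lemma ptensB_r (V : strict_monoidal) (B : algebra V) (M : rmod B) (N : lmod B) :
  ⟦tensB_r M N⟧ = ⟦idm M⟧ ⋆ ⟦lmod_act N⟧.
Proof. by rewrite pof_scomp pof_ten pcompf1 //; obs. Qed.

Lemma ptensB_q (V : ambient) (B : algebra V) (M : rmod B) (N : lmod B) :
  ⟦tensB_q M N⟧ • (⟦rmod_act M⟧ ⋆ ⟦idm N⟧)
  = ⟦tensB_q M N⟧ • (⟦idm M⟧ ⋆ ⟦lmod_act N⟧).
Proof.
rewrite -ptensB_r -pof_ten -!pof_comp.
by congr pof; exact: (proj1 (coeqmP (tensB_l M N) (tensB_r M N))).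
Qed.

Lemma ptensB_epi (V : ambient) (B : algebra V) (M : rmod B) (N : lmod B)
  (X Y W W' : V) (Z : V) (u : hom X W) (v : hom Y W') :
  X = tensB M N ⊗ Z -> Y = tensB M N ⊗ Z -> W = W' ->
  ⟦u⟧ • (⟦tensB_q M N⟧ ⋆ ⟦idm Z⟧) = ⟦v⟧ • (⟦tensB_q M N⟧ ⋆ ⟦idm Z⟧) ->
  ⟦u⟧ = ⟦v⟧.
Proof.
move=> e1 e2 e3; subst; rewrite -pof_ten -!pof_comp => /pof_inj.
by move=> /(coequalizer_epi (tensr_coeq Z (coeqmP _ _))) ->.
Qed.

Lemma ptensB_epi1 (V : ambient) (B : algebra V) (M : rmod B) (N : lmod B)
  (X Y W W' : V) (u : hom X W) (v : hom Y W') :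
  X = tensB M N -> Y = tensB M N -> W = W' ->
  ⟦u⟧ • ⟦tensB_q M N⟧ = ⟦v⟧ • ⟦tensB_q M N⟧ -> ⟦u⟧ = ⟦v⟧.
Proof.
move=> e1 e2 e3 E; apply: (@ptensB_epi _ _ M N _ _ _ _ 𝟙); rewrite ?tenoI //.
by rewrite ptenf1.
Qed.

Lemma tensB_map_subproof (V : ambient) (B : algebra V) (N : lmod B)
  (M M' : rmod B) (f : hom M M') : is_rmod_mor f ->
  tensB_q M' N ∘ (f ⊠ idm N) ∘ tensB_l M N
  = tensB_q M' N ∘ (f ⊠ idm N) ∘ tensB_r M N.
Proof.
move=> /(f_equal pof); rewrite !pof_comp pof_ten => fP; apply: pof_inj.
rewrite [LHS]pof_comp [RHS]pof_comp pof_comp ptensB_r /tensB_l !pof_ten -!pcompA.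
rewrite ptenCl // fP -ptenCl // pcompA ptensB_q -!pcompA -ptenA; congr (_ • _).
by rewrite -pof_id_ten !ptenC // !pcompf1 // !pcomp1f.
Qed.

Definition tensB_map (V : ambient) (B : algebra V) (N : lmod B)
    (M M' : rmod B) (f : rmod_hom M M') : hom (tensB M N) (tensB M' N) :=
  tensB_desc (tensB_map_subproof N (proj2_sig f)).

Lemma tensB_mapE (V : ambient) (B : algebra V) (N : lmod B)
  (M M' : rmod B) (f : rmod_hom M M') :
  tensB_map N f ∘ tensB_q M N = tensB_q M' N ∘ (proj1_sig f ⊠ idm N).
Proof. exact: coeq_descE. Qed.

Lemma ptensB_map (V : ambient) (B : algebra V) (N : lmod B)
  (M M' : rmod B) (f : rmod_hom M M') :
  ⟦tensB_map N f⟧ • ⟦tensB_q M N⟧ = ⟦tensB_q M' N⟧ • (⟦proj1_sig f⟧ ⋆ ⟦idm N⟧).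
Proof. by rewrite -pof_comp tensB_mapE pof_comp. Qed.

Lemma tensB_map1 (V : ambient) (B : algebra V) (N : lmod B) (M : rmod B) :
  tensB_map N (rmod_idm M) = idm (tensB M N).
Proof.
apply: coequalizer_epi (coeqmP (tensB_l M N) (tensB_r M N)) _ _ _ _.
by rewrite [LHS]tensB_mapE /= tenm1 compf1 comp1f.
Qed.

Lemma tensB_map_comp (V : ambient) (B : algebra V) (N : lmod B)
  (M M' M'' : rmod B) (g : rmod_hom M' M'') (f : rmod_hom M M') :
  tensB_map N (rmod_comp g f) = tensB_map N g ∘ tensB_map N f.
Proof.
apply: coequalizer_epi (coeqmP (tensB_l M N) (tensB_r M N)) _ _ _ _.
rewrite [LHS]tensB_mapE /= tensr_subproof2 compA -tensB_mapE -!compA.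
by congr (_ ∘ _); rewrite -tensB_mapE.
Qed.

Lemma pbimod (V : strict_monoidal) (B A : algebra V) (N : bimod B A) :
  ⟦bimod_ract N⟧ • (⟦lmod_act N⟧ ⋆ ⟦idm A⟧)
  = ⟦lmod_act N⟧ • (⟦idm B⟧ ⋆ ⟦bimod_ract N⟧).
Proof. by rewrite -!pof_ten -!pof_comp; exact: heq_pof (bimodP N). Qed.

Lemma tensB_act_subproof (V : ambient) (B A : algebra V) (M : rmod B)
  (N : bimod B A) :
  tensB_q M N ⊙ (idm M ⊠ bimod_ract N) ⊙ idm (M ⊗ N ⊗ A)
    ∘ (tensB_l M N ⊠ idm A)
  = tensB_q M N ⊙ (idm M ⊠ bimod_ract N) ⊙ idm (M ⊗ N ⊗ A)
    ∘ (tensB_r M N ⊠ idm A).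
Proof.
apply: pof_inj.
rewrite [LHS]pof_comp [RHS]pof_comp !pof_scomp pof_ten pcompf1; try obs.
rewrite (pof_ten (tensB_r M N)) ptensB_r !pof_ten -ptenA -!pcompA.
rewrite -ptenA ptenCr; try obs.
rewrite pbimod -ptenCr; try obs.
rewrite (pcompA _ _ (_ ⋆ (⟦idm B⟧ ⋆ _))) -ptensB_q -pcompA; congr (_ • _).
rewrite -pof_id_ten ptenA -pof_id_ten !ptenC; try obs.
by rewrite !pcompf1 ?pcomp1f; try obs.
Qed.

(* The morphism M ⊗_B xi for the right action xi : N ⊗ A -> N, with source
   M ⊗_B (N ⊗ A) = (M ⊗_B N) ⊗ A since - ⊗ A preserves coequalizers. *)
Definition tensB_act (V : ambient) (B A : algebra V) (M : rmod B)
    (N : bimod B A) : hom (tensB M N ⊗ A) (tensB M N) :=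
  tensB_descr (tensB_act_subproof M N).

Lemma ptensB_act (V : ambient) (B A : algebra V) (M : rmod B) (N : bimod B A) :
  ⟦tensB_act M N⟧ • (⟦tensB_q M N⟧ ⋆ ⟦idm A⟧)
  = ⟦tensB_q M N⟧ • (⟦idm M⟧ ⋆ ⟦bimod_ract N⟧).
Proof.
rewrite -pof_ten -pof_comp /tensB_act.
rewrite [X in ⟦X⟧](coeq_descE _ (tensB_act_subproof M N)) !pof_scomp pcompf1 //.
by obs.
Qed.

Lemma prmodA (V : strict_monoidal) (A : algebra V) (X : V) (xi : hom (X ⊗ A) X) :
  is_rmod xi ->
  ⟦xi⟧ • (⟦xi⟧ ⋆ ⟦idm A⟧) = ⟦xi⟧ • (⟦idm X⟧ ⋆ ⟦alg_mul A⟧).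
Proof.
by move=> P; rewrite -!pof_ten -!pof_comp; exact: heq_pof (rmod_actA P).
Qed.

Lemma prmod1 (V : strict_monoidal) (A : algebra V) (X : V) (xi : hom (X ⊗ A) X) :
  is_rmod xi -> ⟦xi⟧ • (⟦idm X⟧ ⋆ ⟦alg_unit A⟧) = ⟦idm X⟧.
Proof.
by move=> P; rewrite -!pof_ten -!pof_comp; exact: heq_pof (rmod_act1 P).
Qed.

Lemma tensB_rmodP (V : ambient) (B A : algebra V) (M : rmod B) (N : bimod B A) :
  is_rmod (tensB_act M N).
Proof.
split; apply: pof_heq.
- apply: (@ptensB_epi _ _ M N _ _ _ _ (A ⊗ A)); try obs.
  rewrite !pof_comp !pof_ten pof_id_ten -!pcompA !ptenA.
  rewrite ptenCl; try obs.
  rewrite ptensB_act -ptenCl; try obs.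
  rewrite pcompA ptensB_act -pcompA -ptenA ptenCr; try obs.
  rewrite (prmodA (bimod_rmodP N)) -!ptenA -pof_id_ten ptenC; try obs.
  rewrite pcomp1f; try obs.
  rewrite pcompf1; try obs.
  have -> : ⟦tensB_q M N⟧ ⋆ ⟦alg_mul A⟧
      = (⟦tensB_q M N⟧ ⋆ ⟦idm A⟧) • (⟦idm M⟧ ⋆ (⟦idm N⟧ ⋆ ⟦alg_mul A⟧)).
    rewrite ptenA -pof_id_ten ptenC; try obs.
    by rewrite pcompf1 // pcomp1f.
  rewrite pcompA ptensB_act -pcompA ptenCr; try obs.
  by [].
- apply: (@ptensB_epi1 _ _ M N) => //; try obs.
  rewrite !pof_comp !pof_ten -pcompA -{1}[⟦tensB_q M N⟧]ptenf1 ptenC; try obs.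
  rewrite !pcomp1f ?pcompf1; try obs.
  have -> : ⟦tensB_q M N⟧ ⋆ ⟦alg_unit A⟧
      = (⟦tensB_q M N⟧ ⋆ ⟦idm A⟧) • (⟦idm M⟧ ⋆ (⟦idm N⟧ ⋆ ⟦alg_unit A⟧)).
    rewrite ptenA -pof_id_ten ptenC; try obs.
    by rewrite pcompf1 // pcomp1f.
  rewrite pcompA ptensB_act -pcompA ptenCr; try obs.
  by rewrite (prmod1 (bimod_rmodP N)) -pof_id_ten pcompf1.
Qed.

Lemma tensB_map_act (V : ambient) (B A : algebra V) (N : bimod B A)
  (M M' : rmod B) (f : rmod_hom M M') :
  tensB_map N f ∘ tensB_act M N = tensB_act M' N ∘ (tensB_map N f ⊠ idm A).
Proof.
apply: pof_inj; apply: (@ptensB_epi _ _ M N _ _ _ _ A) => //.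
rewrite !pof_comp pof_ten -!pcompA ptensB_act ptenCl // ptensB_map.
rewrite pcompA ptensB_map -ptenCl // pcompA ptensB_act -!pcompA; congr (_ • _).
rewrite -ptenA -pof_id_ten !ptenC //.
by rewrite !pcompf1 // !pcomp1f.
Qed.

Definition tensB_rmod (V : ambient) (B A : algebra V) (M : rmod B)
    (N : bimod B A) : rmod A :=
  RMod (tensB_rmodP M N).

Definition tensB_rmod_map (V : ambient) (B A : algebra V) (N : bimod B A)
    (M M' : rmod B) (f : rmod_hom M M') :
    rmod_hom (tensB_rmod M N) (tensB_rmod M' N) :=
  exist _ (tensB_map N f) (tensB_map_act N f).

Definition tensB_functor (V : ambient) (B A : algebra V) (N : bimod B A) :
    functor (rmod_cat B) (rmod_cat A).
Proof.
refine (@Functor (rmod_cat B) (rmod_cat A) (fun M => tensB_rmod M N)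
  (fun M M' f => tensB_rmod_map N f) _ _).
- by move=> M; apply: sig_eqP; exact: tensB_map1.
- by move=> M M' M'' g f; apply: sig_eqP; exact: tensB_map_comp.
Defined.

Definition left_faithfully_flat (V : ambient) (B A : algebra V)
    (N : bimod B A) : Prop :=
  preserves_equalizers (tensB_functor N) /\ conservative (tensB_functor N).

Lemma coinv_rmodP (V : ambient) (H : bialgebra V) (A : comod_algebra H) :
  is_rmod (A := coinv A) (alg_mul A ∘ (idm A ⊠ coinv_i A)).
Proof.
split; apply: pof_heq; rewrite !pof_comp !pof_ten ?pof_comp ?pof_ten.
- rewrite -!pcompA !ptenC; try obs.
  rewrite pcomp1f; try obs.
  rewrite pcompf1; try obs.
  rewrite pcomp1f; try obs.
  rewrite pcoinv_mul -ptenCr; try obs.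
  have -> : (⟦alg_mul A⟧ • (⟦idm A⟧ ⋆ ⟦coinv_i A⟧)) ⋆ ⟦coinv_i A⟧
      = (⟦alg_mul A⟧ ⋆ ⟦idm A⟧) • (⟦idm A⟧ ⋆ ⟦coinv_i A⟧ ⋆ ⟦coinv_i A⟧).
    by rewrite ptenC // pcomp1f.
  by rewrite !pcompA pmulA ptenA.
- rewrite -pcompA ptenCr; try obs.
  by rewrite pcoinv_unit pmulm1.
Qed.

Lemma coinv_lmodP (V : ambient) (H : bialgebra V) (A : comod_algebra H) :
  is_lmod (A := coinv A) (alg_mul A ∘ (coinv_i A ⊠ idm A)).
Proof.
split; apply: pof_heq; rewrite !pof_comp !pof_ten ?pof_comp ?pof_ten.
- rewrite -!pcompA !ptenC; try obs.
  rewrite pcomp1f; try obs.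
  rewrite pcompf1; try obs.
  rewrite pcomp1f; try obs.
  rewrite pcoinv_mul -ptenCl; try obs.
  have -> : ⟦coinv_i A⟧ ⋆ (⟦alg_mul A⟧ • (⟦coinv_i A⟧ ⋆ ⟦idm A⟧))
      = (⟦idm A⟧ ⋆ ⟦alg_mul A⟧) • (⟦coinv_i A⟧ ⋆ (⟦coinv_i A⟧ ⋆ ⟦idm A⟧)).
    by rewrite ptenC // pcomp1f.
  by rewrite !pcompA pmulA ptenA.
- rewrite -pcompA ptenCl; try obs.
  by rewrite pcoinv_unit pmul1m.
Qed.

Lemma alg_rmodP (V : strict_monoidal) (A : algebra V) : is_rmod (alg_mul A).
Proof. by split; [exact: alg_mulA (algP A) | exact: alg_mulm1 (algP A)]. Qed.

Lemma coinv_bimodP (V : ambient) (H : bialgebra V) (A : comod_algebra H) :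
  alg_mul A ∘ ((alg_mul A ∘ (coinv_i A ⊠ idm A)) ⊠ idm A)
  ≈ alg_mul A ∘ (coinv_i A ⊠ idm A) ∘ (idm (coinv_ob A) ⊠ alg_mul A).
Proof.
apply: pof_heq; rewrite !pof_comp !pof_ten pof_comp pof_ten -ptenCl; try obs.
rewrite pcompA pmulA -!pcompA -ptenA -pof_id_ten !ptenC; try obs.
by rewrite !pcomp1f // !pcompf1.
Qed.

Definition coinv_rmod (V : ambient) (H : bialgebra V) (A : comod_algebra H) :
    rmod (coinv A) :=
  RMod (coinv_rmodP A).

Definition coinv_lmod (V : ambient) (H : bialgebra V) (A : comod_algebra H) :
    lmod (coinv A) :=
  LMod (coinv_lmodP A).

Definition coinv_bimod (V : ambient) (H : bialgebra V) (A : comod_algebra H) :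
    bimod (coinv A) A :=
  @Bimod V (coinv A) A (coinv_lmod A) (alg_mul A) (alg_rmodP A) (coinv_bimodP A).

Lemma can_subproof (V : ambient) (H : bialgebra V) (A : comod_algebra H) :
  (alg_mul A ⊠ idm H) ⊙ (idm A ⊠ ca_coact A)
    ∘ tensB_l (coinv_rmod A) (coinv_lmod A)
  = (alg_mul A ⊠ idm H) ⊙ (idm A ⊠ ca_coact A)
    ∘ tensB_r (coinv_rmod A) (coinv_lmod A).
Proof.
apply: pof_inj; rewrite [LHS]pof_comp [RHS]pof_comp pof_scomp ptensB_r.
rewrite !pof_ten /= !pof_comp !pof_ten -!pcompA.
rewrite ptenCr; try obs.
rewrite pca_lin -ptenCr; try obs.
rewrite (ptenA _ ⟦alg_mul A⟧) [RHS]pcompA ptenCl; try obs.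
rewrite -pmulA -[in RHS]ptenCl; try obs.
rewrite -[RHS]pcompA; congr (_ • _).
rewrite -(ptenA _ ⟦idm A⟧) -pof_id_ten ptenA !ptenC; try obs.
by rewrite !pcomp1f // !pcompf1.
Qed.

Definition can (V : ambient) (H : bialgebra V) (A : comod_algebra H) :
    hom (tensB (coinv_rmod A) (coinv_lmod A)) (A ⊗ H) :=
  tensB_desc (can_subproof A).

Definition galois (V : ambient) (H : bialgebra V) (A : comod_algebra H) : Prop :=
  is_iso (can A).

Lemma Fbar_coact_subproof (V : ambient) (H : bialgebra V) (A : comod_algebra H)
  (M : rmod (coinv A)) :
  (tensB_q M (coinv_lmod A) ⊠ idm H) ⊙ (idm M ⊠ ca_coact A)
    ∘ tensB_l M (coinv_lmod A)
  = (tensB_q M (coinv_lmod A) ⊠ idm H) ⊙ (idm M ⊠ ca_coact A)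
    ∘ tensB_r M (coinv_lmod A).
Proof.
apply: pof_inj; rewrite [LHS]pof_comp [RHS]pof_comp pof_scomp ptensB_r.
rewrite !pof_ten /= pof_comp pof_ten -!pcompA.
rewrite ptenCr; try obs.
rewrite pca_lin.
have -> : (⟦alg_mul A⟧ ⋆ ⟦idm H⟧) • (⟦coinv_i A⟧ ⋆ ⟦ca_coact A⟧)
   = (⟦lmod_act (coinv_lmod A)⟧ ⋆ ⟦idm H⟧)
     • (⟦idm (coinv_ob A)⟧ ⋆ ⟦ca_coact A⟧).
  rewrite pof_comp pof_ten -ptenCl; try obs.
  rewrite -!pcompA; congr (_ • _).
  rewrite -ptenA -pof_id_ten ptenC; try obs.
  by rewrite pcompf1 ?pcomp1f.
rewrite -ptenCr; try obs.
rewrite ptenA [RHS]pcompA ptenCl; try obs.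
rewrite -(ptensB_q M (coinv_lmod A)) -[in RHS]ptenCl; try obs.
rewrite -[RHS]pcompA; congr (_ • _).
rewrite -(ptenA _ _ ⟦idm H⟧) -pof_id_ten ptenA -pof_id_ten !ptenC; try obs.
by rewrite !pcomp1f ?pcompf1; try obs.
Qed.

(* The morphism M ⊗_B α_A. *)
Definition Fbar_coact (V : ambient) (H : bialgebra V) (A : comod_algebra H)
    (M : rmod (coinv A)) :
    hom (tensB M (coinv_bimod A)) (tensB M (coinv_bimod A) ⊗ H) :=
  tensB_desc (Fbar_coact_subproof M).

Lemma pFbar_coact (V : ambient) (H : bialgebra V) (A : comod_algebra H)
  (M : rmod (coinv A)) :
  ⟦Fbar_coact M⟧ • ⟦tensB_q M (coinv_lmod A)⟧
  = (⟦tensB_q M (coinv_lmod A)⟧ ⋆ ⟦idm H⟧) • (⟦idm M⟧ ⋆ ⟦ca_coact A⟧).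
Proof.
rewrite -pof_comp [X in ⟦X⟧](coeq_descE _ (Fbar_coact_subproof M)).
by rewrite pof_scomp.
Qed.

Lemma prcomodA (V : strict_monoidal) (C : coalgebra V) (X : V)
  (nu : hom X (X ⊗ C)) : is_rcomod nu ->
  (⟦nu⟧ ⋆ ⟦idm C⟧) • ⟦nu⟧ = (⟦idm X⟧ ⋆ ⟦coalg_comul C⟧) • ⟦nu⟧.
Proof.
by move=> P; rewrite -!pof_ten -!pof_comp; exact: heq_pof (rcomod_coactA P).
Qed.

Lemma prcomod1 (V : strict_monoidal) (C : coalgebra V) (X : V)
  (nu : hom X (X ⊗ C)) : is_rcomod nu ->
  (⟦idm X⟧ ⋆ ⟦coalg_counit C⟧) • ⟦nu⟧ = ⟦idm X⟧.
Proof.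
by move=> P; rewrite -!pof_ten -!pof_comp; exact: heq_pof (rcomod_coact1 P).
Qed.

Lemma Fbar_rcomodP (V : ambient) (H : bialgebra V) (A : comod_algebra H)
  (M : rmod (coinv A)) : is_rcomod (C := bi_coalg H) (Fbar_coact M).
Proof.
set q := ⟦tensB_q M (coinv_lmod A)⟧.
have qE X Y (f : hom X Y) : q ⋆ ⟦f⟧
    = (q ⋆ ⟦idm Y⟧) • (⟦idm M⟧ ⋆ (⟦idm A⟧ ⋆ ⟦f⟧)).
  rewrite ptenA -pof_id_ten ptenC; try obs.
  by rewrite pcompf1 // pcomp1f.
have nuE X Y (f : hom X Y) : (⟦idm (tensB M (coinv_lmod A))⟧ ⋆ ⟦f⟧) • (q ⋆ ⟦idm X⟧)
    = q ⋆ ⟦f⟧.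
  by rewrite ptenC // pcomp1f // pcompf1.
split; apply: pof_heq; apply: (@ptensB_epi1 _ _ M (coinv_lmod A)) => //; try obs.
- rewrite !pof_comp !pof_ten -!pcompA pFbar_coact !pcompA ptenCl //.
  rewrite pFbar_coact -ptenCl; try obs.
  rewrite nuE qE -/q -!pcompA -!(ptenA ⟦idm M⟧) !ptenCr; try obs.
  by rewrite (prcomodA (ca_comodP A)) pof_id_ten ptenA.
- rewrite pof_comp pof_ten -!pcompA pFbar_coact pcompA nuE qE.
  rewrite -!pcompA ptenCr; try obs.
  rewrite (prcomod1 (ca_comodP A)) ptenf1 -pof_id_ten pcompf1 //.
  by rewrite pcomp1f.
Qed.

Lemma Fbar_compat (V : ambient) (H : bialgebra V) (A : comod_algebra H)
  (M : rmod (coinv A)) :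
  Fbar_coact M ∘ tensB_act M (coinv_bimod A)
  = (tensB_act M (coinv_bimod A) ⊠ idm H)
    ⊙ (idm (tensB M (coinv_bimod A)) ⊠ entwining A) ⊙ (Fbar_coact M ⊠ idm A).
Proof.
apply: pof_inj; apply: (@ptensB_epi _ _ M (coinv_lmod A) _ _ _ _ A) => //.
rewrite pof_comp !pof_scomp !pof_ten -!pcompA (ptensB_act M (coinv_bimod A)).
rewrite pcompA pFbar_coact -pcompA ptenCr; try obs.
rewrite pca_entmod ptenCl; try obs.
rewrite pFbar_coact -ptenCl; try obs.
set q := ⟦tensB_q M _⟧.
rewrite -(ptenA q) -pof_id_ten (pcompA (_ ⋆ ⟦entwining A⟧)).
rewrite (ptenC (g' := ⟦entwining A⟧)); try obs.
rewrite pcomp1f; try obs.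
rewrite pcompf1; try obs.
have -> : q ⋆ ⟦entwining A⟧
    = (q ⋆ ⟦idm A⟧ ⋆ ⟦idm H⟧) • (⟦idm M⟧ ⋆ (⟦idm A⟧ ⋆ ⟦entwining A⟧)).
  rewrite -ptenA (ptenA ⟦idm M⟧) -!pof_id_ten ptenC; try obs.
  by rewrite pcompf1 // pcomp1f.
rewrite !pcompA ptenCl; try obs.
rewrite (ptensB_act M (coinv_bimod A)) -ptenCl; try obs.
rewrite -!pcompA; congr (_ • _).
by rewrite -!ptenA !ptenCr; try obs.
Qed.

Definition Fbar_ob (V : ambient) (H : bialgebra V) (A : comod_algebra H)
    (M : rmod (coinv A)) : entmod (C := bi_coalg H) (entwining A) :=
  @EntMod V (bi_coalg H) A (entwining A) (tensB M (coinv_bimod A))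
    (tensB_act M (coinv_bimod A)) (Fbar_coact M)
    (tensB_rmodP M (coinv_bimod A)) (Fbar_rcomodP M) (Fbar_compat M).

Lemma Fbar_map_subproof (V : ambient) (H : bialgebra V) (A : comod_algebra H)
  (M M' : rmod (coinv A)) (f : rmod_hom M M') :
  is_entmod_mor (X := Fbar_ob M) (Y := Fbar_ob M') (tensB_map (coinv_bimod A) f).
Proof.
split; first exact: tensB_map_act.
apply: pof_inj; apply: (@ptensB_epi1 _ _ M (coinv_lmod A)) => //=.
rewrite !pof_comp pof_ten -!pcompA ptensB_map pFbar_coact !pcompA ptenCl //.
rewrite ptensB_map pFbar_coact -ptenCl //.
rewrite -!pcompA; congr (_ • _).
rewrite -ptenA -pof_id_ten !ptenC //.
by rewrite !pcompf1 // !pcomp1f.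
Qed.

Definition Fbar_map (V : ambient) (H : bialgebra V) (A : comod_algebra H)
    (M M' : rmod (coinv A)) (f : rmod_hom M M') :
    entmod_hom (Fbar_ob M) (Fbar_ob M') :=
  exist _ (tensB_map (coinv_bimod A) f) (Fbar_map_subproof f).

Definition Fbar (V : ambient) (H : bialgebra V) (A : comod_algebra H) :
    functor (rmod_cat (coinv A))
      (@entmod_cat V (bi_coalg H) A (entwining A)).
Proof.
refine (@Functor (rmod_cat (coinv A)) (@entmod_cat V (bi_coalg H) A (entwining A))
  (@Fbar_ob V H A) (@Fbar_map V H A) _ _).
- by move=> M; apply: sig_eqP; exact: tensB_map1.
- by move=> M M' M'' g f; apply: sig_eqP; exact: tensB_map_comp.
Defined.

(* Main.v *)
From Corelib Require Import ssreflect.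
From Stdlib Require Import ClassicalEpsilon.
Require Import Defs.

(** The functor F = - ⊗_B A, with B the algebra of coinvariants of A, has as
right adjoint the functor of coinvariants, X ↦ X^H, the equalizer of the
coaction of X and of X ⊗ e_H; the counit X^H ⊗_B A -> X is x ⊗ a ↦ xa.  This is
[mcoinv_counit_universal].  On the other hand every A-module X gives the cofree
entwined module X ⊗ H, and a Galois map X ⊗_B A -> X ⊗ H, x ⊗ a ↦ x a_0 ⊗ a_1,
whose instance at X = A is can.  Both directions play these two universal
properties against each other.

Suppose that A is Galois and faithfully flat.  Then the Galois map of every
A-module is invertible, since x ⊗ h ↦ x can^-1(1 ⊗ h) is an inverse
([galois_map_iso]).  For an entwined module X, the equalizer that defines X^H is
an equalizer of B-modules, so it is preserved by - ⊗_B A; under the Galois maps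
of X and of X ⊗ H its image becomes the parallel pair ν ⊗ H, X ⊗ δ from X ⊗ H to
X ⊗ H ⊗ H, whose equalizer is ν : X -> X ⊗ H, and the comparison map is the
counit.  So the counit is invertible ([mcoinv_counit_iso]), and conservativity
of - ⊗_B A makes the unit invertible as well ([equivalence_of_counit]).

Suppose that F is an equivalence.  The Galois map of X is a universal arrow from
F to the cofree module X ⊗ H ([galois_map_universal]): by the universal
properties of ⊗_B and of the cofree module, morphisms F(M) -> X ⊗ H, A-linear
maps M ⊗_B A -> X, and B-linear maps M -> X correspond to each other.  Universal
arrows of an equivalence are invertible, in particular can.  Finally - ⊗_B A is
F followed by the functor that forgets the coaction; the latter is conservative,
and flatness of H makes it preserve equalizers ([forget_coact_equalizers]). *)

Set Implicit Arguments.
Unset Strict Implicit.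
Unset Printing Implicit Defensive.
Local Open Scope cat_scope.

(** * Equivalences of categories *)
Section Equivalences.
Variables (C D : category) (F : functor C D).

Definition faithful := forall (X Y : C) (f g : hom X Y),
  fmap F f = fmap F g -> f = g.
Definition full := forall (X Y : C) (h : hom (F X) (F Y)),
  exists f : hom X Y, fmap F f = h.
Definition ess_surj := forall Y : D, exists (X : C) (f : hom (F X) Y), is_iso f.

Lemma iso_mono (X Y Z : C) (i : hom Y Z) (f g : hom X Y) :
  is_iso i -> i ∘ f = i ∘ g -> f = g.
Proof.
by move=> [j [ji _]] E; rewrite -(comp1f f) -ji -compA E compA ji comp1f.
Qed.

Lemma iso_epi (X Y Z : C) (i : hom X Y) (f g : hom Y Z) :
  is_iso i -> f ∘ i = g ∘ i -> f = g.
Proof.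
by move=> [j [_ ij]] E; rewrite -(compf1 f) -ij compA E -compA ij compf1.
Qed.
End Equivalences.

Lemma fmap_iso (C D : category) (F : functor C D) (X Y : C) (f : hom X Y) :
  is_iso f -> is_iso (fmap F f).
Proof.
by move=> [g [gf fg]]; exists (fmap F g); rewrite -!fmap_comp gf fg !fmap1.
Qed.

(** f is conjugate to G (F f) along the isomorphism from G F to the identity. *)
Lemma equivalence_faithful (C D : category) (F : functor C D) :
  is_equivalence F -> faithful F.
Proof.
move=> [G [[a [a_nat a_iso]] _]] X Y f g E.
by apply: (iso_epi (a_iso X)); rewrite -[f ∘ _]a_nat -[g ∘ _]a_nat /= E.
Qed.

Lemma equivalence_full (C D : category) (F : functor C D) :
  is_equivalence F -> full F.
Proof.
move=> [G [[a [a_nat a_iso]] [b [b_nat b_iso]]]] X Y h.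
have G_faithful X' Y' (u v : hom X' Y') : fmap G u = fmap G v -> u = v.
  move=> E; apply: (iso_epi (b_iso X')).
  by rewrite -[u ∘ _]b_nat -[v ∘ _]b_nat /= E.
have [a' [a'a aa']] := a_iso X.
exists (a Y ∘ fmap G h ∘ a'); apply: G_faithful.
apply: (iso_mono (a_iso Y)).
by rewrite [LHS]a_nat /= -compA a'a compf1.
Qed.

Lemma equivalence_ess_surj (C D : category) (F : functor C D) :
  is_equivalence F -> ess_surj F.
Proof.
by move=> [G [_ [b [_ b_iso]]]] Y; exists (G Y), (b Y); exact: b_iso.
Qed.

Lemma equivalence_conservative (C D : category) (F : functor C D) :
  is_equivalence F -> conservative F.
Proof.
move=> E X Y f [k [kf fk]]; have [g gE] := equivalence_full E k.
by exists g; split; apply: (equivalence_faithful E);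
  rewrite fmap_comp gE fmap1.
Qed.

Lemma equivalence_equalizers (C D : category) (F : functor C D) :
  is_equivalence F -> preserves_equalizers F.
Proof.
move=> E X Y K f g e [fge eP].
have Ff := equivalence_faithful E.
split=> [|Z h fgh]; first by rewrite -!fmap_comp fge.
have [W [b b_iso]] := equivalence_ess_surj E Z.
have [k kE] := equivalence_full E (h ∘ b).
have [b' [b'b bb']] := b_iso.
have fgk : f ∘ k = g ∘ k by apply: Ff; rewrite !fmap_comp kE !compA fgh.
have [u [uk u_uniq]] := eP W k fgk.
exists (fmap F u ∘ b'); split=> [|v vh].
  by rewrite compA -fmap_comp uk kE -compA bb' compf1.
have [w wE] := equivalence_full E (v ∘ b).
have -> : u = w.
  by apply: u_uniq; apply: Ff; rewrite fmap_comp wE kE compA vh.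
by rewrite wE -compA bb' compf1.
Qed.

Definition universal_arrow (C D : category) (F : functor C D) (Y : D) (R : C)
    (e : hom (F R) Y) : Prop :=
  forall (X : C) (h : hom (F X) Y), exists! f : hom X R, e ∘ fmap F f = h.

(** Essential surjectivity gives e a section s; since F is full, s ∘ e is the
image of an endomorphism of R, which the uniqueness part of universality
identifies with the identity. *)
Lemma equivalence_universal_iso (C D : category) (F : functor C D) (Y : D)
  (R : C) (e : hom (F R) Y) :
  is_equivalence F -> universal_arrow e -> is_iso e.
Proof.
move=> E eU; have [X [h [h' [h'h hh']]]] := equivalence_ess_surj E Y.
have [f [ef _]] := eU X h.
have es : e ∘ (fmap F f ∘ h') = idm Y by rewrite compA ef.
exists (fmap F f ∘ h'); split=> //.
have [k kE] := equivalence_full E (fmap F f ∘ h' ∘ e).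
have [j [_ j_uniq]] := eU R e.
rewrite -kE -fmap1; congr (fmap F _).
have jk : j = k by apply: j_uniq; rewrite kE compA es comp1f.
by rewrite -jk; apply: j_uniq; rewrite fmap1 compf1.
Qed.

(** The universal arrows make R a right adjoint of F with counit e.  By the
triangle identity F maps each unit to the inverse of e, so that a conservative F
makes the units invertible too. *)
Lemma equivalence_of_counit (C D : category) (F : functor C D) (R : D -> C)
  (e : forall Y, hom (F (R Y)) Y) :
  (forall Y, universal_arrow (e Y)) -> (forall Y, is_iso (e Y)) ->
  conservative F -> is_equivalence F.
Proof.
move=> eU e_iso F_cons.
pose T X Y h := constructive_indefinite_description _ (eU Y X h).
pose t X Y h := proj1_sig (T X Y h).
have tE X Y h : e Y ∘ fmap F (t X Y h) = h := proj1 (proj2_sig (T X Y h)).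
have tU X Y (f g : hom X (R Y)) : e Y ∘ fmap F f = e Y ∘ fmap F g -> f = g.
  have [k [_ kU]] := eU Y X (e Y ∘ fmap F g).
  by move=> /kU <-; apply: kU.
have R1 X : t _ _ (idm X ∘ e X) = idm (R X).
  by apply: tU; rewrite tE fmap1 comp1f compf1.
have R2 X Y Z (g : hom Y Z) (f : hom X Y) :
    t _ _ (g ∘ f ∘ e X) = t _ _ (g ∘ e Y) ∘ t _ _ (f ∘ e X).
  by apply: tU; rewrite tE fmap_comp compA tE -!compA tE.
exists (@Functor D C R (fun X Y f => t _ _ (f ∘ e X)) R1 R2).
have t_iso X : is_iso (t X (F X) (idm _)).
  apply: F_cons; have [e' [e'e ee']] := e_iso (F X).
  exists (e (F X)); split; first exact: tE.
  apply: (iso_mono (e_iso _)).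
  by rewrite compA tE comp1f compf1.
split; last by exists e; split=> // X Y f /=; rewrite tE.
pose I X := constructive_indefinite_description _ (t_iso X).
exists (fun X => proj1_sig (I X)); split=> [X Y f /=|X]; last first.
  by case: (I X) => /= i [it ti]; exists (t X (F X) (idm _)).
case: (I X) => /= i [it ti]; case: (I Y) => /= j [jt tj].
apply: (iso_epi (t_iso X)); rewrite -!compA it compf1.
apply: (iso_mono (t_iso Y)); rewrite compA tj comp1f; apply: tU.
by rewrite !fmap_comp !compA !tE -compA tE comp1f compf1.
Qed.

(** * Strand calculus *)

(** Computations are done on morphisms whose sources and targets are bracketed
to the right, X ⊗ (Y ⊗ (... ⊗ Z)), with a spare factor Z at the end: there
[onmn f Z] lets f act on the first m strands, returning n strands, and [X ◁ f]
leaves the first strand alone.  In this form composition needs no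
reassociation, and the interchange law becomes naturality in Z.  Setting Z to
the unit object gives back the original morphisms.  The operations are chosen
from opaque existence proofs, so that unification never unfolds them. *)
Lemma strand_sig (V : strict_monoidal) (X Y Z X' Y' : V) (f : hom X Y) :
  X ⊗ Z = X' -> Y ⊗ Z = Y' -> {h : hom X' Y' | ⟦h⟧ = ⟦f⟧ ⋆ ⟦idm Z⟧}.
Proof. by move=> eX eY; destruct eX, eY; exists (f ⊠ idm Z). Qed.

Lemma lwhisker_sig (V : strict_monoidal) (X Y Z : V) (f : hom Y Z) :
  {h : hom (X ⊗ Y) (X ⊗ Z) | ⟦h⟧ = ⟦idm X⟧ ⋆ ⟦f⟧}.
Proof. by exists (idm X ⊠ f). Qed.

Definition lwhisker (V : strict_monoidal) (X Y Z : V) (f : hom Y Z) :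
    hom (X ⊗ Y) (X ⊗ Z) := proj1_sig (lwhisker_sig X f).

Notation "X ◁ f" := (lwhisker X f)
  (at level 39, right associativity) : cat_scope.

Section Strands.
Variable V : strict_monoidal.
Implicit Types X Y Z W U : V.

Definition on11 X W (f : hom X W) Z : hom (X ⊗ Z) (W ⊗ Z) :=
  proj1_sig (strand_sig f eq_refl eq_refl).
Definition on21 X Y W (f : hom (X ⊗ Y) W) Z : hom (X ⊗ (Y ⊗ Z)) (W ⊗ Z) :=
  proj1_sig (strand_sig f (eq_sym (tenoA X Y Z)) eq_refl).
Definition on12 X W U (f : hom X (W ⊗ U)) Z : hom (X ⊗ Z) (W ⊗ (U ⊗ Z)) :=
  proj1_sig (strand_sig f eq_refl (eq_sym (tenoA W U Z))).
Definition on22 X Y W U (f : hom (X ⊗ Y) (W ⊗ U)) Z :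
    hom (X ⊗ (Y ⊗ Z)) (W ⊗ (U ⊗ Z)) :=
  proj1_sig (strand_sig f (eq_sym (tenoA X Y Z)) (eq_sym (tenoA W U Z))).
Definition on01 W (f : hom 𝟙 W) Z : hom Z (W ⊗ Z) :=
  proj1_sig (strand_sig f (tenIo Z) eq_refl).
Definition on10 X (f : hom X 𝟙) Z : hom (X ⊗ Z) Z :=
  proj1_sig (strand_sig f eq_refl (tenIo Z)).

Lemma plw X Y Z (f : hom Y Z) : ⟦X ◁ f⟧ = ⟦idm X⟧ ⋆ ⟦f⟧.
Proof. exact: proj2_sig (lwhisker_sig X f). Qed.
Lemma pon11 X W (f : hom X W) Z : ⟦on11 f Z⟧ = ⟦f⟧ ⋆ ⟦idm Z⟧.
Proof. exact: proj2_sig (strand_sig f _ _). Qed.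
Lemma pon21 X Y W (f : hom (X ⊗ Y) W) Z : ⟦on21 f Z⟧ = ⟦f⟧ ⋆ ⟦idm Z⟧.
Proof. exact: proj2_sig (strand_sig f _ _). Qed.
Lemma pon12 X W U (f : hom X (W ⊗ U)) Z : ⟦on12 f Z⟧ = ⟦f⟧ ⋆ ⟦idm Z⟧.
Proof. exact: proj2_sig (strand_sig f _ _). Qed.
Lemma pon22 X Y W U (f : hom (X ⊗ Y) (W ⊗ U)) Z :
  ⟦on22 f Z⟧ = ⟦f⟧ ⋆ ⟦idm Z⟧.
Proof. exact: proj2_sig (strand_sig f _ _). Qed.
Lemma pon01 W (f : hom 𝟙 W) Z : ⟦on01 f Z⟧ = ⟦f⟧ ⋆ ⟦idm Z⟧.
Proof. exact: proj2_sig (strand_sig f _ _). Qed.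
Lemma pon10 X (f : hom X 𝟙) Z : ⟦on10 f Z⟧ = ⟦f⟧ ⋆ ⟦idm Z⟧.
Proof. exact: proj2_sig (strand_sig f _ _). Qed.

Definition pstrands := (pon21, pon12, pon22, pon01, pon10, plw, pon11).

Local Ltac pwhisker := apply: pof_inj;
  rewrite ?pof_comp ?pstrands ?pof_comp ?pstrands ?ptenCl ?ptenCr
    -?pof_id_ten //.

Lemma lw_comp X Y Z W (g : hom Z W) (f : hom Y Z) :
  X ◁ (g ∘ f) = (X ◁ g) ∘ (X ◁ f).
Proof. by pwhisker. Qed.
Lemma lw1 X Y : X ◁ idm Y = idm (X ⊗ Y).
Proof. by pwhisker. Qed.
Lemma on11_comp X Y W (g : hom Y W) (f : hom X Y) Z :
  on11 (g ∘ f) Z = on11 g Z ∘ on11 f Z.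
Proof. by pwhisker. Qed.
Lemma on11_1 X Z : on11 (idm X) Z = idm (X ⊗ Z).
Proof. by pwhisker. Qed.

Local Ltac pnat := apply: pof_inj; rewrite !pof_comp !pstrands;
  rewrite ?ptenA -?pof_id_ten; rewrite ?ptenC //; try obs;
  rewrite ?pcomp1f ?pcompf1 //; try obs.

Lemma nat11 X W (f : hom X W) Z Z' (k : hom Z Z') :
  (W ◁ k) ∘ on11 f Z = on11 f Z' ∘ (X ◁ k).
Proof. by pnat. Qed.
Lemma nat21 X Y W (f : hom (X ⊗ Y) W) Z Z' (k : hom Z Z') :
  (W ◁ k) ∘ on21 f Z = on21 f Z' ∘ (X ◁ Y ◁ k).
Proof. by pnat. Qed.
Lemma nat12 X W U (f : hom X (W ⊗ U)) Z Z' (k : hom Z Z') :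
  (W ◁ U ◁ k) ∘ on12 f Z = on12 f Z' ∘ (X ◁ k).
Proof. by pnat. Qed.
Lemma nat22 X Y W U (f : hom (X ⊗ Y) (W ⊗ U)) Z Z' (k : hom Z Z') :
  (W ◁ U ◁ k) ∘ on22 f Z = on22 f Z' ∘ (X ◁ Y ◁ k).
Proof. by pnat. Qed.
Lemma nat01 W (f : hom 𝟙 W) Z Z' (k : hom Z Z') :
  (W ◁ k) ∘ on01 f Z = on01 f Z' ∘ k.
Proof.
apply: pof_inj; rewrite !pof_comp !pstrands -{2}[⟦k⟧]pten1f.
by rewrite !ptenC //; try obs; rewrite ?pcomp1f ?pcompf1.
Qed.

Lemma nat10 X (f : hom X 𝟙) Z Z' (k : hom Z Z') :
  k ∘ on10 f Z = on10 f Z' ∘ (X ◁ k).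
Proof.
apply: pof_inj; rewrite !pof_comp !pstrands -{1}[⟦k⟧]pten1f.
by rewrite !ptenC //; try obs; rewrite ?pcomp1f ?pcompf1.
Qed.

(** Composites are kept associated to the right.  [compr] rewrites with an
equation inside such a chain, and [lw_eq] under a whiskering. *)
Lemma compr (C : category) (X Y Z T : C) (g : hom Y Z) (f : hom X Y)
  (h : hom X Z) (E : g ∘ f = h) (k : hom T X) : g ∘ (f ∘ k) = h ∘ k.
Proof. by rewrite compA E. Qed.

Lemma compAr (C : category) (X Y Z T : C) (h : hom Z T) (g : hom Y Z)
  (f : hom X Y) : h ∘ g ∘ f = h ∘ (g ∘ f).
Proof. by rewrite compA. Qed.

Lemma lw_eq X Y Z W (g : hom Z W) (f : hom Y Z) (h : hom Y W) (E : g ∘ f = h) :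
  (X ◁ g) ∘ (X ◁ f) = X ◁ h.
Proof. by rewrite -lw_comp E. Qed.

Lemma on21_comp X Y P W (g : hom P W) (f : hom (X ⊗ Y) P) Z :
  on21 (g ∘ f) Z = on11 g Z ∘ on21 f Z.
Proof. by pwhisker. Qed.
Lemma on12_comp X P W U (g : hom P (W ⊗ U)) (f : hom X P) Z :
  on12 (g ∘ f) Z = on12 g Z ∘ on11 f Z.
Proof. by pwhisker. Qed.
Lemma on01_comp X W (g : hom X W) (f : hom 𝟙 X) Z :
  on01 (g ∘ f) Z = on11 g Z ∘ on01 f Z.
Proof. by pwhisker. Qed.
Lemma on21_tenl X Y X' W (g : hom (X' ⊗ Y) W) (f : hom X X') Z :
  on21 (g ∘ (f ⊠ idm Y)) Z = on21 g Z ∘ on11 f (Y ⊗ Z).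
Proof. by pwhisker; rewrite pof_ten -ptenCl // pof_id_ten ptenA. Qed.
Lemma on21_tenr X Y Y' W (g : hom (X ⊗ Y') W) (f : hom Y Y') Z :
  on21 (g ∘ (idm X ⊠ f)) Z = on21 g Z ∘ (X ◁ on11 f Z).
Proof. by pwhisker; rewrite pof_ten -ptenCl // ptenA. Qed.

Lemma on11_inj X Y (f g : hom X Y) : on11 f 𝟙 = on11 g 𝟙 -> f = g.
Proof. by move=> /(f_equal pof); rewrite !pstrands !ptenf1 => /pof_inj. Qed.
Lemma on21_inj X Y W (f g : hom (X ⊗ Y) W) : on21 f 𝟙 = on21 g 𝟙 -> f = g.
Proof. by move=> /(f_equal pof); rewrite !pstrands !ptenf1 => /pof_inj. Qed.
Lemma on12_inj X W U (f g : hom X (W ⊗ U)) : on12 f 𝟙 = on12 g 𝟙 -> f = g.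
Proof. by move=> /(f_equal pof); rewrite !pstrands !ptenf1 => /pof_inj. Qed.
Lemma on22_inj X Y W U (f g : hom (X ⊗ Y) (W ⊗ U)) :
  on22 f 𝟙 = on22 g 𝟙 -> f = g.
Proof. by move=> /(f_equal pof); rewrite !pstrands !ptenf1 => /pof_inj. Qed.

Lemma on12K X Y Z : on21 (idm (X ⊗ Y)) Z ∘ on12 (idm (X ⊗ Y)) Z = idm _.
Proof. by pwhisker; rewrite ?pcomp1f -?pof_id_ten ?tenoA. Qed.

Lemma on12_on21 X Y P W U (g : hom P (W ⊗ U)) (f : hom (X ⊗ Y) P) Z :
  on12 g Z ∘ on21 f Z = on22 (g ∘ f) Z.
Proof. by pwhisker. Qed.

Lemma on21_on12 P W U Q (g : hom (W ⊗ U) Q) (f : hom P (W ⊗ U)) Z :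
  on21 g Z ∘ on12 f Z = on11 (g ∘ f) Z.
Proof. by pwhisker. Qed.

Lemma on22_1 X Y Z : on22 (idm (X ⊗ Y)) Z = idm (X ⊗ (Y ⊗ Z)).
Proof. by pwhisker; rewrite !pof_id_ten ptenA. Qed.

(** The maps x ↦ x ⊗ e and x ⊗ w ↦ x e(w). *)
Definition insr X W (e : hom 𝟙 W) : hom X (X ⊗ W) := (idm X ⊠ e) ⊙ idm X.

Lemma insr_strands X W (e : hom 𝟙 W) Z : on12 (insr X e) Z = X ◁ on01 e Z.
Proof.
apply: pof_inj; rewrite !pstrands pof_scomp pof_ten.
by rewrite pcompf1 ?ptenA; try obs.
Qed.

Definition delr X W (e : hom W 𝟙) : hom (X ⊗ W) X := idm X ⊙ (idm X ⊠ e).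

Lemma delr_strands X W (e : hom W 𝟙) Z : on21 (delr X e) Z = X ◁ on10 e Z.
Proof.
apply: pof_inj; rewrite !pstrands pof_scomp pof_ten.
by rewrite pcomp1f ?ptenA; try obs.
Qed.

(** The strand form [on12 (idm (X ⊗ Y)) Z] of an identity only splits a
compound strand X ⊗ Y into two; it is invertible, so equations between morphisms
into a compound strand may be checked after splitting it. *)
Lemma split_on11 P W U (f : hom P (W ⊗ U)) Z :
  on12 (idm (W ⊗ U)) Z ∘ on11 f Z = on12 f Z.
Proof. by rewrite -on12_comp comp1f. Qed.

Lemma split_inj X Y Z W (u v : hom W (X ⊗ Y ⊗ Z)) :
  on12 (idm (X ⊗ Y)) Z ∘ u = on12 (idm (X ⊗ Y)) Z ∘ v -> u = v.
Proof.
by move=> E; rewrite -(comp1f u) -(comp1f v) -!on12K -!compA E.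
Qed.

End Strands.

(** Given adjacent layers a and b that act on disjoint strands in the wrong
order, [square] returns the naturality equation that exchanges them.  In the
order chosen, layers acting further to the left come later; exceptions are
splittings and morphisms between single strands, which come as early as
possible.  [slide] normalizes both sides of the goal in this way. *)
Ltac square a b := lazymatch constr:((a, b)) with
  | (on11 ?f _, lwhisker _ ?k) => constr:(eq_sym (nat11 f k))
  | (lwhisker ?W ?k, on21 ?f ?Z) => constr:(nat21 f k)
  | (_, on12 (idm _) _) => fail
  | (on12 (idm ?X) _, lwhisker _ ?k) => constr:(eq_sym (nat12 (idm X) k))
  | (lwhisker ?W (lwhisker ?U ?k), on12 ?f ?Z) => constr:(nat12 f k)
  | (lwhisker ?W (lwhisker ?U ?k), on22 ?f ?Z) => constr:(nat22 f k)
  | (lwhisker ?W ?k, on01 ?f ?Z) => constr:(nat01 f k)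
  | (?k, on10 ?f ?Z) => constr:(nat10 f k)
  | (lwhisker ?W ?a', lwhisker _ ?b') =>
      let E := square a' b' in constr:(lw_eq W E)
  end.

Ltac slide_step := match goal with
  | |- context [?a ∘ (?b ∘ ?h)] => let E := square a b in rewrite (compr E h)
  | |- context [?a ∘ ?b] => let E := square a b in rewrite E
  end.

Ltac slide :=
  rewrite ?lw_comp ?compAr; repeat (slide_step; rewrite ?lw_comp ?compAr).

(** * Structures on strands *)

Section Structures.
Variable V : strict_monoidal.
Implicit Types X Y Z W U : V.

Lemma act_act (A : algebra V) X (xi : hom (X ⊗ A) X) (P : is_rmod xi) Z :
  on21 xi Z ∘ on21 xi (A ⊗ Z) = on21 xi Z ∘ (X ◁ on21 (alg_mul A) Z).
Proof.
apply: pof_inj; rewrite !pof_comp !pstrands pof_id_ten !ptenA ptenCl //.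
by rewrite (prmodA P) -ptenCl //; obs.
Qed.

Lemma act_unit (A : algebra V) X (xi : hom (X ⊗ A) X) (P : is_rmod xi) Z :
  on21 xi Z ∘ (X ◁ on01 (alg_unit A) Z) = idm (X ⊗ Z).
Proof.
apply: pof_inj; rewrite !pof_comp !pstrands !ptenA ptenCl; try obs.
by rewrite (prmod1 P) -pof_id_ten.
Qed.

(** The converses, here and for the other structures below, ask for the
equations at Z = 𝟙 only: a subobject of a module inherits its equations by
cancelling a monomorphism, which need not remain one after tensoring with Z. *)
Lemma is_rmod_strands (A : algebra V) X (xi : hom (X ⊗ A) X) :
  on21 xi 𝟙 ∘ on21 xi (A ⊗ 𝟙) = on21 xi 𝟙 ∘ (X ◁ on21 (alg_mul A) 𝟙) ->
  on21 xi 𝟙 ∘ (X ◁ on01 (alg_unit A) 𝟙) = idm (X ⊗ 𝟙) ->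
  is_rmod xi.
Proof.
move=> /(f_equal pof); rewrite !pof_comp !pstrands pof_id_ten !ptenf1 => EA.
move=> /(f_equal pof); rewrite !pof_comp !pstrands pof_id_ten !ptenf1 => E1.
by split; apply: pof_heq; rewrite !pof_comp !pof_ten.
Qed.

Lemma mul_mul (A : algebra V) Z :
  on21 (alg_mul A) Z ∘ on21 (alg_mul A) (A ⊗ Z)
  = on21 (alg_mul A) Z ∘ (A ◁ on21 (alg_mul A) Z).
Proof. exact: act_act (alg_rmodP A) Z. Qed.

Lemma mul_unitr (A : algebra V) Z :
  on21 (alg_mul A) Z ∘ (A ◁ on01 (alg_unit A) Z) = idm (A ⊗ Z).
Proof. exact: act_unit (alg_rmodP A) Z. Qed.

Lemma mul_unitl (A : algebra V) Z :
  on21 (alg_mul A) Z ∘ on01 (alg_unit A) (A ⊗ Z) = idm (A ⊗ Z).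
Proof.
apply: pof_inj; rewrite !pof_comp !pstrands pof_id_ten !ptenA ptenCl; try obs.
by rewrite pmul1m.
Qed.

Lemma rmod_mor_strands (A : algebra V) (M N : rmod A) (f : hom M N) :
  on11 f 𝟙 ∘ on21 (rmod_act M) 𝟙 = on21 (rmod_act N) 𝟙 ∘ on11 f (A ⊗ 𝟙) ->
  is_rmod_mor f.
Proof.
move=> E; apply: on21_inj.
by rewrite [LHS]on21_comp [RHS]on21_tenl.
Qed.

Lemma mor_act (A : algebra V) (M N : rmod A) (f : hom M N)
  (P : is_rmod_mor f) Z :
  on11 f Z ∘ on21 (rmod_act M) Z = on21 (rmod_act N) Z ∘ on11 f (A ⊗ Z).
Proof. by rewrite -[LHS]on21_comp -[RHS]on21_tenl P. Qed.
End Structures.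

Section Braiding.
Variable V : braided.
Implicit Types X Y Z W U : V.

Lemma pbraid_hexr X Y Z :
  ⟦σ X (Y ⊗ Z)⟧ = (⟦idm Y⟧ ⋆ ⟦σ X Z⟧) • (⟦σ X Y⟧ ⋆ ⟦idm Z⟧).
Proof. by have := heq_pof (braid_hexr X Y Z); rewrite pof_scomp. Qed.

Lemma pbraid_hexl X Y Z :
  ⟦σ (X ⊗ Y) Z⟧ = (⟦σ X Z⟧ ⋆ ⟦idm Y⟧) • (⟦idm X⟧ ⋆ ⟦σ Y Z⟧).
Proof. by have := heq_pof (braid_hexl X Y Z); rewrite pof_scomp. Qed.

(** By the hexagon, σ X 𝟙 is an idempotent isomorphism. *)
Lemma pbraid1r X : ⟦σ X 𝟙⟧ = ⟦idm X⟧.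
Proof.
have [t [ts st]] := braid_iso X (𝟙 : V).
have E : ⟦σ X 𝟙⟧ • ⟦σ X 𝟙⟧ = ⟦σ X 𝟙⟧.
  have := pbraid_hexr X 𝟙 𝟙; rewrite pten1f ptenf1 => <-.
  have EI := f_equal (fun Z : V => ⟦σ X Z⟧) (tenIo (𝟙 : V)); exact: EI.
have := f_equal (fun f => ⟦t⟧ • f) E.
rewrite /= pcompA -pof_comp ts pcomp1f; first by obs.
by move=> ->; rewrite pof_id_ten ptenf1.
Qed.

Lemma braid_mulr X Y Y' W (f : hom (Y ⊗ Y') W) Z :
  on22 (σ X W) Z ∘ (X ◁ on21 f Z)
  = on21 f (X ⊗ Z) ∘ (Y ◁ on22 (σ X Y') Z) ∘ on22 (σ X Y) (Y' ⊗ Z).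
Proof.
apply: pof_inj; rewrite !pof_comp !pstrands !pof_id_ten !ptenA ptenCl //.
rewrite pbraid_nat pbraid_hexr -!ptenCl; try obs.
by rewrite pcompA.
Qed.

Lemma braid_comulr X Y Y' W (f : hom W (Y ⊗ Y')) Z :
  on12 f (X ⊗ Z) ∘ on22 (σ X W) Z
  = (Y ◁ on22 (σ X Y') Z) ∘ on22 (σ X Y) (Y' ⊗ Z) ∘ (X ◁ on12 f Z).
Proof.
apply: pof_inj; rewrite !pof_comp !pstrands !pof_id_ten !ptenA ptenCl //.
rewrite -pbraid_nat pbraid_hexr -!ptenCl; try obs.
by [].
Qed.

Lemma braid_mull X X' Y W (f : hom (X ⊗ X') W) Z :
  on22 (σ W Y) Z ∘ on21 f (Y ⊗ Z)
  = (Y ◁ on21 f Z) ∘ on22 (σ X Y) (X' ⊗ Z) ∘ (X ◁ on22 (σ X' Y) Z).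
Proof.
apply: pof_inj; rewrite !pof_comp !pstrands !pof_id_ten !ptenA ptenCl //.
rewrite pbraid_nat pbraid_hexl -!ptenCl; try obs.
by rewrite pcompA.
Qed.

Lemma braid_comull X X' Y W (f : hom W (X ⊗ X')) Z :
  (Y ◁ on12 f Z) ∘ on22 (σ W Y) Z
  = on22 (σ X Y) (X' ⊗ Z) ∘ (X ◁ on22 (σ X' Y) Z) ∘ on12 f (Y ⊗ Z).
Proof.
apply: pof_inj; rewrite !pof_comp !pstrands !pof_id_ten !ptenA ptenCl //.
rewrite -pbraid_nat pbraid_hexl -!ptenCl; try obs.
by [].
Qed.

Lemma braid_unitr X W (e : hom 𝟙 W) Z :
  on22 (σ X W) Z ∘ (X ◁ on01 e Z) = on01 e (X ⊗ Z).
Proof.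
apply: pof_inj; rewrite !pof_comp !pstrands !pof_id_ten !ptenA ptenCl; try obs.
by rewrite pbraid_nat pbraid1r pcompf1; try obs.
Qed.

Lemma braid_unitl Y W (e : hom 𝟙 W) Z :
  on22 (σ W Y) Z ∘ on01 e (Y ⊗ Z) = Y ◁ on01 e Z.
Proof.
apply: pof_inj; rewrite !pof_comp !pstrands !pof_id_ten !ptenA ptenCl; try obs.
by rewrite pbraid_nat pbraid1 pcompf1; try obs.
Qed.

Lemma braid_counitl X Y (e : hom X 𝟙) Z :
  (Y ◁ on10 e Z) ∘ on22 (σ X Y) Z = on10 e (Y ⊗ Z).
Proof.
apply: pof_inj; rewrite !pof_comp !pstrands !pof_id_ten !ptenA ptenCl; try obs.
by rewrite -pbraid_nat pbraid1 pcomp1f; try obs.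
Qed.
End Braiding.

Section Bialgebra.
Variables (V : braided) (H : bialgebra V) (A : comod_algebra H).
Implicit Types X Y Z : V.
Local Notation δ := (on12 (bi_comul H)).
Local Notation ε := (on10 (bi_counit H)).
Local Notation λ := (on22 (entwining A)).

Section Comodule.
Variables (X : V) (nu : hom X (X ⊗ H)).
Hypothesis nuP : is_rcomod (C := bi_coalg H) nu.

Lemma coact_coact Z : on12 nu (H ⊗ Z) ∘ on12 nu Z = (X ◁ δ Z) ∘ on12 nu Z.
Proof.
apply: pof_inj; rewrite !pof_comp !pstrands pof_id_ten !ptenA !ptenCl //.
by rewrite (prcomodA nuP).
Qed.

Lemma coact_counit Z : (X ◁ ε Z) ∘ on12 nu Z = idm (X ⊗ Z).
Proof.
apply: pof_inj; rewrite !pof_comp !pstrands !ptenA !ptenCl //.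
by rewrite (prcomod1 nuP) -pof_id_ten.
Qed.
End Comodule.

Lemma is_rcomod_strands X (nu : hom X (X ⊗ H)) :
  on12 nu (H ⊗ 𝟙) ∘ on12 nu 𝟙 = (X ◁ δ 𝟙) ∘ on12 nu 𝟙 ->
  (X ◁ ε 𝟙) ∘ on12 nu 𝟙 = idm (X ⊗ 𝟙) ->
  is_rcomod (C := bi_coalg H) nu.
Proof.
move=> /(f_equal pof); rewrite !pof_comp !pstrands pof_id_ten !ptenf1 => EA.
move=> /(f_equal pof); rewrite !pof_comp !pstrands pof_id_ten !ptenf1 => E1.
by split; apply: pof_heq; rewrite !pof_comp !pof_ten.
Qed.

Lemma comul_comul Z : δ (H ⊗ Z) ∘ δ Z = (H ◁ δ Z) ∘ δ Z.
Proof. by apply: coact_coact; case: (bi_coalgP H) => dA d1l d1r; split. Qed.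

Lemma comul_counitr Z : (H ◁ ε Z) ∘ δ Z = idm (H ⊗ Z).
Proof. by apply: coact_counit; case: (bi_coalgP H) => dA d1l d1r; split. Qed.

Lemma comul_counitl Z : ε (H ⊗ Z) ∘ δ Z = idm (H ⊗ Z).
Proof.
apply: pof_inj; rewrite !pof_comp !pstrands pof_id_ten !ptenA ptenCl; try obs.
by rewrite (pcoalg1m (bi_coalg H)).
Qed.

Lemma comod_mor_strands X Y (nuX : hom X (X ⊗ H)) (nuY : hom Y (Y ⊗ H))
  (f : hom X Y) :
  on12 nuY 𝟙 ∘ on11 f 𝟙 = on11 f (H ⊗ 𝟙) ∘ on12 nuX 𝟙 ->
  nuY ∘ f = (f ⊠ idm H) ∘ nuX.
Proof.
move=> /(f_equal pof); rewrite !pof_comp !pstrands pof_id_ten !ptenf1 => E.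
by apply: pof_inj; rewrite !pof_comp.
Qed.

(** The coaction with its target expressed through H rather than through the
coalgebra underlying H, so that it can be rewritten in strands. *)
Definition ecoact (X : entmod (C := bi_coalg H) (entwining A)) :
  hom X (X ⊗ H) := entmod_coact X.

Lemma ecoactP (X : entmod (C := bi_coalg H) (entwining A)) :
  is_rcomod (C := bi_coalg H) (ecoact X).
Proof. exact: entmod_rcomodP. Qed.

Section EntwinedModule.
Variables X Y : entmod (C := bi_coalg H) (entwining A).

Lemma ecoact_act Z :
  on12 (ecoact X) Z ∘ on21 (entmod_act X) Z
  = on21 (entmod_act X) (H ⊗ Z) ∘ (X ◁ λ Z) ∘ on12 (ecoact X) (A ⊗ Z).
Proof.
rewrite on12_on21 [ecoact X ∘ _](entmod_compat X).
rewrite /ecoact; move: (entmod_coact X) (entmod_act X).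
move: (entwining A) (entmod_ob X) => l T nu xi.
apply: pof_inj.
rewrite !pof_comp !pstrands !pof_scomp !pof_ten !pof_id_ten !ptenA.
by rewrite ptenCl ?ptenCl; try obs.
Qed.

Lemma mor_ecoact (f : hom X Y) (P : is_entmod_mor f) Z :
  on12 (ecoact Y) Z ∘ on11 f Z = on11 f (H ⊗ Z) ∘ on12 (ecoact X) Z.
Proof.
rewrite -on12_comp [ecoact Y ∘ _](proj2 P); apply: pof_inj.
by rewrite pof_comp !pstrands pof_comp pof_ten -ptenCl // pof_id_ten ptenA.
Qed.

Lemma mor_eact (f : hom X Y) (P : is_entmod_mor f) Z :
  on11 f Z ∘ on21 (entmod_act X) Z = on21 (entmod_act Y) Z ∘ on11 f (A ⊗ Z).
Proof.
by rewrite -on21_comp (proj1 P) on21_tenl.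
Qed.
End EntwinedModule.

Lemma entmod_strands X (xi : hom (X ⊗ A) X) (nu : hom X (X ⊗ H)) :
  on12 nu 𝟙 ∘ on21 xi 𝟙 = on21 xi (H ⊗ 𝟙) ∘ (X ◁ λ 𝟙) ∘ on12 nu (A ⊗ 𝟙) ->
  nu ∘ xi = (xi ⊠ idm H) ⊙ (idm X ⊠ entwining A) ⊙ (nu ⊠ idm A).
Proof.
move: (entwining A) => l.
move=> /(f_equal pof); rewrite !pof_comp !pstrands !pof_id_ten !ptenf1 => E.
by apply: pof_inj; rewrite pof_comp !pof_scomp.
Qed.

Lemma comul_mul Z :
  on12 (bi_comul H) Z ∘ on21 (alg_mul H) Z
  = on21 (alg_mul H) (H ⊗ Z) ∘ (H ◁ H ◁ on21 (alg_mul H) Z)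
    ∘ (H ◁ on22 (σ H H) (H ⊗ Z)) ∘ on12 (bi_comul H) (H ⊗ (H ⊗ Z))
    ∘ (H ◁ on12 (bi_comul H) Z).
Proof.
have E : ⟦bi_comul H⟧ • ⟦alg_mul H⟧
    = (⟦alg_mul H⟧ ⋆ ⟦alg_mul H⟧) • (⟦idm H⟧ ⋆ ⟦σ H H⟧ ⋆ ⟦idm H⟧)
      • (⟦bi_comul H⟧ ⋆ ⟦bi_comul H⟧).
  rewrite -pof_comp (proj2 (bi_comul_mor H)) pof_comp !pof_scomp !pof_ten.
  by rewrite [X in X • _]pcompf1 //; obs.
apply: pof_inj; rewrite !pof_comp !pstrands !pof_id_ten !ptenA ptenCl //.
rewrite E.
have -> : ⟦bi_comul H⟧ ⋆ ⟦bi_comul H⟧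
    = (⟦bi_comul H⟧ ⋆ ⟦idm H⟧ ⋆ ⟦idm H⟧) • (⟦idm H⟧ ⋆ ⟦bi_comul H⟧).
  by rewrite -ptenA -pof_id_ten ptenC // pcompf1 // pcomp1f.
have -> : ⟦alg_mul H⟧ ⋆ ⟦alg_mul H⟧
    = (⟦alg_mul H⟧ ⋆ ⟦idm H⟧) • (⟦idm H⟧ ⋆ ⟦idm H⟧ ⋆ ⟦alg_mul H⟧).
  by rewrite -pof_id_ten ptenC // pcompf1 // pcomp1f.
rewrite -!ptenCl; try obs.
by rewrite !pcompA.
Qed.

Lemma counit_mul Z :
  on10 (bi_counit H) Z ∘ on21 (alg_mul H) Z
  = on10 (bi_counit H) Z ∘ on10 (bi_counit H) (H ⊗ Z).
Proof.
have E : ⟦bi_counit H⟧ • ⟦alg_mul H⟧ = ⟦bi_counit H⟧ ⋆ ⟦bi_counit H⟧.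
  rewrite -pof_comp (proj2 (bi_counit_mor H)) pof_comp !pof_scomp !pof_ten.
  rewrite pcomp1f; try obs.
  by rewrite pcomp1f; try obs.
apply: pof_inj; rewrite !pof_comp !pstrands !pof_id_ten !ptenA ptenCl; try obs.
rewrite ptenCl; try obs.
rewrite E -[X in X • _]pten1f ptenC; try obs.
by rewrite pcomp1f ?pcompf1; try obs.
Qed.

Lemma coact_mul Z :
  on12 (ca_coact A) Z ∘ on21 (alg_mul A) Z
  = on21 (alg_mul A) (H ⊗ Z) ∘ (A ◁ A ◁ on21 (alg_mul H) Z)
    ∘ (A ◁ on22 (σ H A) (H ⊗ Z)) ∘ on12 (ca_coact A) (A ⊗ (H ⊗ Z))
    ∘ (A ◁ on12 (ca_coact A) Z).
Proof.
apply: pof_inj; rewrite !pof_comp !pstrands !pof_id_ten !ptenA ptenCl //.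
rewrite pca_mul.
have -> : ⟦ca_coact A⟧ ⋆ ⟦ca_coact A⟧
    = (⟦ca_coact A⟧ ⋆ ⟦idm A⟧ ⋆ ⟦idm H⟧) • (⟦idm A⟧ ⋆ ⟦ca_coact A⟧).
  by rewrite -ptenA -pof_id_ten ptenC // pcompf1 // pcomp1f.
have -> : ⟦alg_mul A⟧ ⋆ ⟦alg_mul H⟧
    = (⟦alg_mul A⟧ ⋆ ⟦idm H⟧) • (⟦idm A⟧ ⋆ ⟦idm A⟧ ⋆ ⟦alg_mul H⟧).
  by rewrite -pof_id_ten ptenC // pcompf1 // pcomp1f.
rewrite -!ptenCl; try obs.
by rewrite !pcompA.
Qed.

Lemma coact_unit Z :
  on12 (ca_coact A) Z ∘ on01 (alg_unit A) Z
  = on01 (alg_unit A) (H ⊗ Z) ∘ on01 (alg_unit H) Z.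
Proof.
apply: pof_inj; rewrite !pof_comp !pstrands !pof_id_ten !ptenA ptenCl; try obs.
rewrite pca_unit ptenCl; try obs.
rewrite -[in RHS](pten1f ⟦alg_unit H⟧) ptenC; try obs.
by rewrite pcompf1 // pcomp1f.
Qed.

Lemma entwining_strands Z :
  on22 (entwining A) Z
  = (A ◁ on21 (alg_mul H) Z) ∘ on22 (σ H A) (H ⊗ Z) ∘ (H ◁ on12 (ca_coact A) Z).
Proof.
apply: pof_inj; rewrite !pof_comp !pstrands pentwining !pof_id_ten !ptenA.
rewrite ptenCl ?ptenCl //; obs.
Qed.
End Bialgebra.

(** * The entwining of a comodule algebra *)
Section Entwining.
Variables (V : braided) (H : bialgebra V) (A : comod_algebra H).
Implicit Types Z : V.
Local Notation λ := (on22 (entwining A)).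
Local Notation α := (on12 (ca_coact A)).

Lemma ca_coact_coact Z :
  α (H ⊗ Z) ∘ α Z = (A ◁ on12 (bi_comul H) Z) ∘ α Z.
Proof. exact: (coact_coact (ca_comodP A)). Qed.

Lemma ca_coact_counit Z :
  (A ◁ on10 (bi_counit H) Z) ∘ α Z = idm (A ⊗ Z).
Proof. exact: (coact_counit (ca_comodP A)). Qed.

(** The next four lemmas are the axioms of an entwining structure: λ is
compatible with the product and the unit of A, and with the coproduct and the
counit of H. *)
Lemma entwining_mul Z :
  λ Z ∘ (H ◁ on21 (alg_mul A) Z)
  = on21 (alg_mul A) (H ⊗ Z) ∘ (A ◁ λ Z) ∘ λ (A ⊗ Z).
Proof.
rewrite !entwining_strands; slide.
rewrite (lw_eq _ (coact_mul _ _)); slide.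
rewrite (compr (braid_mulr _ _ _)); slide.
rewrite (compr (lw_eq _ (braid_mull _ _ _))); slide.
rewrite (compr (lw_eq _ (lw_eq _ (mul_mul _ _)))); slide.
by [].
Qed.

Lemma entwining_unit Z :
  λ Z ∘ (H ◁ on01 (alg_unit A) Z) = on01 (alg_unit A) (H ⊗ Z).
Proof.
rewrite !entwining_strands; slide.
rewrite (lw_eq _ (coact_unit _ _)); slide.
rewrite (compr (braid_unitr _ _ _)); slide.
by rewrite mul_unitr compf1.
Qed.

Lemma entwining_comul Z :
  (A ◁ on12 (bi_comul H) Z) ∘ λ Z
  = λ (H ⊗ Z) ∘ (H ◁ λ Z) ∘ on12 (bi_comul H) (A ⊗ Z).
Proof.
rewrite !entwining_strands; slide.
rewrite (compr (lw_eq _ (comul_mul _ _))); slide.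
rewrite (compr (braid_comull _ _ _)); slide.
(* The product of H stands between the coaction and the braiding; it is moved
   out of the way to let the coaction pass the braiding. *)
rewrite (compr (lw_eq _ (eq_sym (nat12 (ca_coact A) (on21 (alg_mul H) Z))))).
rewrite ?lw_comp ?compAr.
rewrite (compr (lw_eq _ (braid_comulr _ _ _))); slide.
rewrite (lw_eq _ (ca_coact_coact _)); slide.
by [].
Qed.

Lemma entwining_counit Z :
  (A ◁ on10 (bi_counit H) Z) ∘ λ Z = on10 (bi_counit H) (A ⊗ Z).
Proof.
rewrite !entwining_strands; slide.
rewrite (compr (lw_eq _ (counit_mul _ _))); slide.
rewrite (compr (braid_counitl _ _ _)); slide.
by rewrite (lw_eq _ (ca_coact_counit _)) lw1 compf1.
Qed.

(** The unit of H turns λ into the coaction of A.  Through this identity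
coinvariants enter all later computations. *)
Lemma entwining_unit_coact Z :
  λ Z ∘ on01 (alg_unit H) (A ⊗ Z) = α Z.
Proof.
rewrite !entwining_strands; slide.
rewrite (compr (braid_unitl _ _ _)); slide.
by rewrite (compr (lw_eq _ (mul_unitl _ _))) lw1 comp1f.
Qed.
End Entwining.

(** * Cofree entwined modules *)
Section Cofree.
Variables (V : braided) (H : bialgebra V) (A : comod_algebra H).
Implicit Types (X : rmod A) (Z : V).
Local Notation λ := (on22 (entwining A)).
Local Notation split X Z := (on12 (idm (X ⊗ H)) Z).

(** The action (x ⊗ h) a = x a_0 ⊗ h a_1. *)
Definition cofree_act X : hom (X ⊗ H ⊗ A) (X ⊗ H) :=
  (rmod_act X ⊠ idm H) ⊙ (idm X ⊠ entwining A) ⊙ idm (X ⊗ H ⊗ A).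

Definition cofree_coact X : hom (X ⊗ H) (X ⊗ H ⊗ H) :=
  idm (X ⊗ H ⊗ H) ⊙ (idm X ⊠ bi_comul H).

Lemma cofree_act_strands X Z :
  split X Z ∘ on21 (cofree_act X) Z
  = on21 (rmod_act X) (H ⊗ Z) ∘ (X ◁ λ Z) ∘ split X (A ⊗ Z).
Proof.
rewrite /cofree_act; move: (entwining A) => e.
apply: pof_inj; rewrite !pof_comp !pstrands !pof_scomp !pof_ten.
rewrite pcompf1; try obs.
rewrite -!pof_id_ten pcomp1f; try obs.
rewrite pcompf1; try obs.
rewrite !pof_id_ten !ptenA !ptenCl; try obs.
by [].
Qed.

Lemma cofree_coact_strands X Z :
  split X (H ⊗ Z) ∘ on12 (cofree_coact X) Z
  = (X ◁ on12 (bi_comul H) Z) ∘ split X Z.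
Proof.
have E : ⟦cofree_coact X⟧ = ⟦idm X⟧ ⋆ ⟦bi_comul H⟧.
  by rewrite pof_scomp pcomp1f //; obs.
apply: pof_inj; rewrite !pof_comp !pstrands E -!pof_id_ten.
rewrite pcomp1f; try obs.
rewrite pcompf1; try obs.
by rewrite ptenA.
Qed.

Lemma cofree_rmodP X : is_rmod (cofree_act X).
Proof.
apply: is_rmod_strands; apply: split_inj.
- rewrite !(compr (cofree_act_strands _ _)); slide.
  rewrite cofree_act_strands; slide.
  rewrite (compr (lw_eq _ (entwining_mul _ _))); slide.
  by rewrite (compr (act_act (rmodP X) _)); slide.
- rewrite (compr (cofree_act_strands _ _)); slide.
  rewrite (compr (lw_eq _ (entwining_unit _ _))).
  by rewrite (compr (act_unit (rmodP X) _)) comp1f compf1.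
Qed.

Lemma cofree_rcomodP X : is_rcomod (C := bi_coalg H) (cofree_coact X).
Proof.
apply: is_rcomod_strands; apply: split_inj.
- rewrite (compr (cofree_coact_strands _ _)).
  slide; rewrite cofree_coact_strands; slide.
  by rewrite (compr (lw_eq _ (comul_comul _ _))); slide.
- slide; rewrite cofree_coact_strands.
  by rewrite (compr (lw_eq _ (comul_counitr _ _))) lw1 comp1f compf1.
Qed.

Lemma cofree_compat X :
  cofree_coact X ∘ cofree_act X
  = (cofree_act X ⊠ idm H) ⊙ (idm (X ⊗ H) ⊠ entwining A)
    ⊙ (cofree_coact X ⊠ idm A).
Proof.
apply: entmod_strands; apply: split_inj.
rewrite (compr (cofree_coact_strands _ _)); slide.
rewrite cofree_act_strands (compr (cofree_act_strands _ _)); slide.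
rewrite cofree_coact_strands; slide.
by rewrite (compr (lw_eq _ (entwining_comul _ _))); slide.
Qed.

Definition cofree_rmod X : rmod A := RMod (cofree_rmodP X).

Definition cofree X : entmod (C := bi_coalg H) (entwining A) :=
  @EntMod V (bi_coalg H) A (entwining A) (X ⊗ H) (cofree_act X)
    (cofree_coact X) (cofree_rmodP X) (cofree_rcomodP X) (cofree_compat X).
End Cofree.

(** * Equalizers of modules and of entwined modules *)

Lemma rmod_equalizer (V : strict_monoidal) (A : algebra V) (X Y E : rmod A)
  (f g : rmod_hom X Y) (e : rmod_hom E X) :
  is_equalizer (proj1_sig f) (proj1_sig g) (proj1_sig e) ->
  @is_equalizer (rmod_cat A) X Y E f g e.
Proof.
move=> P; split=> [|Z h fgh]; first by apply: sig_eqP; exact: (proj1 P).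
have [u [uh u_uniq]] := proj2 P Z (proj1_sig h) (f_equal (@proj1_sig _ _) fgh).
have u_lin : is_rmod_mor u.
  apply: (equalizer_mono P).
  rewrite compA uh (proj2_sig h) compA (proj2_sig e) -compA.
  by rewrite -[X in _ = _ ∘ X]tensr_subproof2 uh.
exists (exist _ u u_lin); split=> [|v vh]; first exact: sig_eqP.
by apply: sig_eqP; apply: u_uniq; rewrite -vh.
Qed.

Definition mono (C : category) (X Y : C) (f : hom X Y) : Prop :=
  forall (W : C) (u v : hom W X), f ∘ u = f ∘ v -> u = v.

Lemma mono_pof (C : category) (X Y X' Y' : C) (f : hom X Y) (f' : hom X' Y') :
  X = X' -> Y = Y' -> ⟦f⟧ = ⟦f'⟧ -> mono f -> mono f'.
Proof. by move=> eX eY; destruct eX, eY => /pof_inj ->. Qed.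

Lemma on11_unit_mono (V : strict_monoidal) (X Y : V) (f : hom X Y) :
  mono f -> mono (on11 f 𝟙).
Proof. by apply: mono_pof; rewrite ?tenoI ?pstrands ?ptenf1. Qed.

Section Forgetful.
Variables (V : ambient) (H : bialgebra V) (A : comod_algebra H).
Local Notation entmods := (entmod (C := bi_coalg H) (entwining A)).
Local Notation entcat := (@entmod_cat V (bi_coalg H) A (entwining A)).

Definition entmod_rmod (X : entmods) : rmod A := RMod (entmod_rmodP X).

Definition forget_coact : functor entcat (rmod_cat A).
Proof.
refine (@Functor entcat (rmod_cat A) entmod_rmod
  (fun X Y f => exist _ (proj1_sig f) (proj1 (proj2_sig f))
     : rmod_hom (entmod_rmod X) (entmod_rmod Y)) _ _).
- by move=> X; exact: sig_eqP.
- by move=> X Y Z g f; exact: sig_eqP.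
Defined.

(** An inverse g of a colinear f is colinear: apply g ⊗ H to
ν = ν f g = (f ⊗ H) ν g. *)
Lemma forget_coact_conservative : conservative forget_coact.
Proof.
move=> X Y f [g [/(f_equal (@proj1_sig _ _)) /= gf
  /(f_equal (@proj1_sig _ _)) /= fg]].
have [lin colin] := proj2_sig f.
have g_colin : entmod_coact X ∘ proj1_sig g
    = (proj1_sig g ⊠ idm H) ∘ entmod_coact Y.
  rewrite -[X in _ = _ ∘ X]compf1 -fg (compA (entmod_coact Y)) colin.
  by rewrite !compA -tensr_subproof2 gf tenm1 comp1f.
exists (exist _ (proj1_sig g) (conj (proj2_sig g) g_colin)).
by split; exact: sig_eqP.
Qed.

(** Flatness of H equips the equalizer K of f and g in V with a coaction, which
makes K the equalizer of f and g among entwined modules; any other such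
equalizer e is isomorphic to K. *)
Lemma forget_coact_equalizers :
  flat (bi_alg H : V) -> preserves_equalizers forget_coact.
Proof.
move=> H_flat X Y E f g e [fge eP].
pose f0 := proj1_sig f; pose g0 := proj1_sig g.
have [f_lin f_colin] := proj2_sig f; have [g_lin g_colin] := proj2_sig g.
set K := eqo f0 g0; pose k : hom K X := eqm f0 g0.
have kP : is_equalizer f0 g0 k := eqmP f0 g0.
have kHP := H_flat _ _ _ _ _ _ kP.
have k_mono : mono k by move=> W u v; exact: (equalizer_mono kP).
have k1_mono : mono (on11 k 𝟙) := on11_unit_mono k_mono.
(* Coassociativity and compatibility on K are equations between maps into
   K ⊗ H ⊗ H and K ⊗ H; flatness lets one check them in X. *)
have kH_mono : mono (on11 k (H ⊗ 𝟙)).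
  apply: (@mono_pof _ _ _ _ _ (k ⊠ idm H)); rewrite ?tenoI //.
    by rewrite pstrands.
  by move=> W u v; exact: (equalizer_mono kHP).
have kHH_mono : mono (on11 k (H ⊗ (H ⊗ 𝟙))).
  apply: (@mono_pof _ _ _ _ _ (k ⊠ idm H ⊠ idm H)); rewrite ?tenoI ?tenoA //.
    by rewrite pstrands !pof_ten pof_id_ten ptenA.
  by move=> W u v; exact: (equalizer_mono (H_flat _ _ _ _ _ _ kHP)).
have act_eq : f0 ∘ (entmod_act X ∘ (k ⊠ idm A))
    = g0 ∘ (entmod_act X ∘ (k ⊠ idm A)).
  rewrite !compA f_lin g_lin -!compA -!tensr_subproof2.
  by rewrite (proj1 kP).
pose act := eq_lift kP act_eq.
have actE Z : on11 k Z ∘ on21 act Z = on21 (entmod_act X) Z ∘ on11 k (A ⊗ Z).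
  by rewrite -on21_comp eq_liftE on21_tenl.
have coact_eq : fmap (tensr H) f0 ∘ (ecoact X ∘ k)
    = fmap (tensr H) g0 ∘ (ecoact X ∘ k).
  rewrite !compA -[fmap _ f0 ∘ _]f_colin -[fmap _ g0 ∘ _]g_colin.
  by rewrite -!compA (proj1 kP).
pose coact : hom K (K ⊗ H) := eq_lift kHP coact_eq.
have coactE Z : on11 k (H ⊗ Z) ∘ on12 coact Z = on12 (ecoact X) Z ∘ on11 k Z.
  have E0 : (k ⊠ idm H) ∘ coact = ecoact X ∘ k by exact: eq_liftE.
  rewrite -on12_comp -E0; apply: pof_inj.
  by rewrite pof_comp !pstrands pof_comp pof_ten -ptenCl // pof_id_ten ptenA.
have K_rmodP : is_rmod act.
{ apply: is_rmod_strands; apply: k1_mono.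
  - rewrite !(compr (actE _)); slide.
    rewrite actE; slide.
    by rewrite (compr (act_act (entmod_rmodP X) _)); slide.
  - rewrite !(compr (actE _)); slide.
    by rewrite (compr (act_unit (entmod_rmodP X) _)) comp1f compf1. }
have K_rcomodP : is_rcomod (C := bi_coalg H) coact.
{ apply: is_rcomod_strands.
  - apply: kHH_mono; rewrite !(compr (coactE _)); slide.
    rewrite coactE; slide.
    by rewrite (compr (coact_coact (ecoactP X) _)); slide.
  - apply: k1_mono; slide; rewrite coactE.
    by rewrite (compr (coact_counit (ecoactP X) _)) comp1f compf1. }
have K_compat : coact ∘ act
    = (act ⊠ idm H) ⊙ (idm K ⊠ entwining A) ⊙ (coact ⊠ idm A).
  apply: entmod_strands; apply: kH_mono.
  rewrite (compr (coactE _)); slide; rewrite actE; slide.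
  rewrite (compr (ecoact_act _ _)); slide.
  rewrite (compr (actE _)); slide.
  by rewrite coactE.
pose K_ent : entmods := @EntMod V (bi_coalg H) A (entwining A) K act coact
  K_rmodP K_rcomodP K_compat.
have k_lin : k ∘ act = entmod_act X ∘ (k ⊠ idm A) by exact: eq_liftE.
have k_colin : entmod_coact X ∘ k = (k ⊠ idm H) ∘ coact.
  by rewrite [RHS]eq_liftE.
pose k' : hom (c := entcat) K_ent X := exist _ k (conj k_lin k_colin).
have fgk' : f ∘ k' = g ∘ k' by apply: sig_eqP; exact: (proj1 kP).
have [w [/(f_equal (@proj1_sig _ _)) /= wk _]] := eP K_ent k' fgk'.
have fge0 : f0 ∘ proj1_sig e = g0 ∘ proj1_sig e
  := f_equal (@proj1_sig _ _) fge.
have [e_lin e_colin] := proj2_sig e.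
have [v [kv _]] := proj2 kP _ _ fge0.
have v_mor : is_entmod_mor (X := E) (Y := K_ent) v.
  split.
    apply: k_mono; rewrite compA kv e_lin compA k_lin -compA.
    by rewrite -tensr_subproof2 kv.
  apply: (equalizer_mono kHP); rewrite /= compA -[_ ∘ coact]k_colin -compA kv.
  by rewrite e_colin compA -tensr_subproof2 kv.
have wv : proj1_sig w ∘ v = idm (entmod_ob E).
  have [u [_ u_uniq]] := eP E e fge.
  have E1 : u = idm (c := entcat) E by apply: u_uniq; exact: compf1.
  have E2 : u = w ∘ (exist _ v v_mor : hom (c := entcat) E K_ent).
    by apply: u_uniq; apply: sig_eqP; rewrite /= compA wk.
  exact: (f_equal (@proj1_sig _ _) (eq_trans (eq_sym E2) E1)).
have kR : @is_equalizer (rmod_cat A) _ _ (RMod K_rmodP) (fmap forget_coact f)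
    (fmap forget_coact g) (exist _ k k_lin).
  exact: rmod_equalizer.
split=> [|Z h fgh]; first exact: sig_eqP.
have [u [uh _]] := proj2 kR Z h fgh.
exists (fmap forget_coact w ∘ u); split=> [|u' u'h].
  by rewrite compA -uh; congr (_ ∘ _); exact: sig_eqP.
apply: sig_eqP; rewrite /= -[RHS]comp1f -wv -compA; congr (_ ∘ _).
apply: k_mono; rewrite compA kv.
by rewrite [RHS](f_equal (@proj1_sig _ _) u'h) -uh.
Qed.
End Forgetful.

(** * Tensoring over the coinvariants *)
Section Balanced.
Variables (V : ambient) (H : bialgebra V) (A : comod_algebra H).
Implicit Types (M : rmod (coinv A)) (X : rmod A) (Z W : V).
Local Notation α := (on12 (ca_coact A)).
Local Notation μ := (on21 (alg_mul A)).
Local Notation T M := (tensB M (coinv_bimod A)).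

Definition tensA_q M : hom (M ⊗ A) (T M) := tensB_q M (coinv_bimod A).

Lemma tensA_q_coequalizer M :
  is_coequalizer (tensB_l M (coinv_bimod A)) (tensB_r M (coinv_bimod A))
    (tensA_q M).
Proof. exact: coeqmP. Qed.

Lemma tensB_l_strands M Z :
  on21 (tensA_q M) Z ∘ on21 (rmod_act M) (A ⊗ Z)
  = on21 (tensA_q M) Z ∘ (M ◁ μ Z) ∘ (M ◁ on11 (coinv_i A) (A ⊗ Z)).
Proof.
apply: pof_inj; rewrite !pof_comp !pstrands !pof_id_ten !ptenA.
have E := ptensB_q M (coinv_bimod A).
rewrite /= pof_comp pof_ten -ptenCr in E; try obs.
rewrite ptenCl // E -!ptenCl; try obs.
by rewrite !pcompA !ptenA.
Qed.

(** Morphisms out of M ⊗_B A; the action of B on A is spelled out as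
multiplication after the inclusion of the coinvariants. *)
Lemma tensA_desc_sig M W (h : hom (M ⊗ A) W) :
  on21 h 𝟙 ∘ on21 (rmod_act M) (A ⊗ 𝟙)
  = on21 h 𝟙 ∘ (M ◁ μ 𝟙) ∘ (M ◁ on11 (coinv_i A) (A ⊗ 𝟙)) ->
  {d : hom (T M) W | forall Z, on11 d Z ∘ on21 (tensA_q M) Z = on21 h Z}.
Proof.
move=> /(f_equal pof); rewrite !pof_comp !pstrands !pof_id_ten !ptenf1 => E.
have E' : h ∘ tensB_l M (coinv_bimod A) = h ∘ tensB_r M (coinv_bimod A).
  apply: pof_inj; rewrite [LHS]pof_comp [RHS]pof_comp ptensB_r [LHS]E.
  by rewrite -pcompA ptenCr; try obs; rewrite [in RHS]pof_comp pof_ten.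
exists (tensB_desc E') => Z.
by rewrite -on21_comp [tensB_desc _ ∘ _](coeq_descE _ E').
Qed.

Lemma tensA_epi M Z W (u v : hom (T M ⊗ Z) W) :
  u ∘ on21 (tensA_q M) Z = v ∘ on21 (tensA_q M) Z -> u = v.
Proof.
move=> /(f_equal pof); rewrite !pof_comp !pstrands => E.
apply: pof_inj; exact: (@ptensB_epi _ _ M (coinv_bimod A) _ _ _ _ Z).
Qed.

Lemma lw_tensA_epi Y M Z W (u v : hom (Y ⊗ (T M ⊗ Z)) W) :
  u ∘ (Y ◁ on21 (tensA_q M) Z) = v ∘ (Y ◁ on21 (tensA_q M) Z) -> u = v.
Proof.
move=> /(f_equal pof); rewrite !pof_comp !pstrands -pof_ten => E.
have C := tensl_coeq Y (tensr_coeq Z (tensA_q_coequalizer M)).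
apply: (coequalizer_epi C); apply: pof_inj.
by rewrite [LHS]pof_comp [RHS]pof_comp.
Qed.

Lemma lw_lw_tensA_epi Y Y' M Z W (u v : hom (Y ⊗ (Y' ⊗ (T M ⊗ Z))) W) :
  u ∘ (Y ◁ Y' ◁ on21 (tensA_q M) Z) = v ∘ (Y ◁ Y' ◁ on21 (tensA_q M) Z) ->
  u = v.
Proof.
move=> /(f_equal pof); rewrite !pof_comp !pstrands -!pof_ten => E.
have C := tensl_coeq Y (tensl_coeq Y' (tensr_coeq Z (tensA_q_coequalizer M))).
apply: (coequalizer_epi C); apply: pof_inj.
by rewrite [LHS]pof_comp [RHS]pof_comp.
Qed.

Lemma tensB_act_strands M Z :
  on21 (tensB_act M (coinv_bimod A)) Z ∘ on21 (tensA_q M) (A ⊗ Z)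
  = on21 (tensA_q M) Z ∘ (M ◁ μ Z).
Proof.
apply: pof_inj; rewrite !pof_comp !pstrands !pof_id_ten !ptenA.
rewrite !ptenCl; try obs.
by rewrite (ptensB_act M (coinv_bimod A)).
Qed.

Lemma Fbar_coact_strands M Z :
  on12 (Fbar_coact M) Z ∘ on21 (tensA_q M) Z
  = on21 (tensA_q M) (H ⊗ Z) ∘ (M ◁ α Z).
Proof.
apply: pof_inj; rewrite !pof_comp !pstrands !pof_id_ten !ptenA.
rewrite !ptenCl; try obs.
by rewrite (pFbar_coact M).
Qed.

Lemma tensB_map_strands M M' (f : rmod_hom M M') Z :
  on11 (tensB_map (coinv_bimod A) f) Z ∘ on21 (tensA_q M) Z
  = on21 (tensA_q M') Z ∘ on11 (proj1_sig f) (A ⊗ Z).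
Proof.
apply: pof_inj; rewrite !pof_comp !pstrands !pof_id_ten !ptenA.
rewrite !ptenCl; try obs.
by rewrite (ptensB_map (coinv_bimod A) f).
Qed.

Lemma restrict_strands X Z :
  on21 (rmod_act X ∘ (idm X ⊠ coinv_i A)) Z
  = on21 (rmod_act X) Z ∘ (X ◁ on11 (coinv_i A) Z).
Proof. exact: on21_tenr. Qed.

Lemma coinv_mul_strands Z :
  on11 (coinv_i A) Z ∘ on21 (alg_mul (coinv A)) Z
  = μ Z ∘ on11 (coinv_i A) (A ⊗ Z) ∘ (coinv A ◁ on11 (coinv_i A) Z).
Proof.
rewrite -on21_comp [coinv_i A ∘ _](proj2 (coinv_i_mor A)).
apply: pof_inj; rewrite !pof_comp !pstrands pof_comp pof_ten.
rewrite -ptenCl // pof_id_ten !ptenA -pcompA; congr (_ • _).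
by rewrite ptenCl ?ptenC ?pcompf1 ?pcomp1f.
Qed.

Lemma coinv_unit_strands Z :
  on11 (coinv_i A) Z ∘ on01 (alg_unit (coinv A)) Z = on01 (alg_unit A) Z.
Proof. by rewrite -on01_comp [coinv_i A ∘ _](proj1 (coinv_i_mor A)). Qed.

Lemma coinv_coact_strands Z :
  α Z ∘ on11 (coinv_i A) Z = (A ◁ on01 (alg_unit H) Z) ∘ on11 (coinv_i A) Z.
Proof.
apply: pof_inj; rewrite !pof_comp !pstrands ptenCl // pcoinv ptenA.
rewrite -[X in _ = _ • (X ⋆ _)]ptenf1 ptenCl; try obs.
by rewrite ptenC ?pcomp1f ?pcompf1.
Qed.

Lemma restrict_rmodP X :
  is_rmod (A := coinv A) (rmod_act X ∘ (idm X ⊠ coinv_i A)).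
Proof.
apply: is_rmod_strands; rewrite !restrict_strands; slide.
- rewrite (compr (act_act (rmodP X) _)); slide.
  by rewrite (lw_eq _ (coinv_mul_strands _)); slide.
- by rewrite (lw_eq _ (coinv_unit_strands _)) (act_unit (rmodP X)).
Qed.

Definition restrict X : rmod (coinv A) := RMod (restrict_rmodP X).
End Balanced.

(** * The Galois map of a module *)
Section GaloisMap.
Variables (V : ambient) (H : bialgebra V) (A : comod_algebra H).
Implicit Types (M : rmod (coinv A)) (X : rmod A) (Z W : V).
Local Notation α := (on12 (ca_coact A)).
Local Notation μ := (on21 (alg_mul A)).
Local Notation λ := (on22 (entwining A)).
Local Notation T M := (tensB M (coinv_bimod A)).
Local Notation split X Z := (on12 (idm (X ⊗ H)) Z).

Definition galois_map_lift X : hom (X ⊗ A) (X ⊗ H) :=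
  (rmod_act X ⊠ idm H) ⊙ (idm X ⊠ ca_coact A).

Lemma galois_map_lift_strands X Z :
  split X Z ∘ on21 (galois_map_lift X) Z
  = on21 (rmod_act X) (H ⊗ Z) ∘ (X ◁ α Z).
Proof.
apply: pof_inj; rewrite !pof_comp !pstrands !pof_scomp !pof_ten -pof_id_ten.
rewrite pcomp1f; try obs.
by rewrite !pof_id_ten !ptenA ptenCl; try obs.
Qed.

Lemma coact_linear Z :
  α Z ∘ μ Z = μ (H ⊗ Z) ∘ (A ◁ λ Z) ∘ α (A ⊗ Z).
Proof.
rewrite coact_mul entwining_strands; slide.
by [].
Qed.

(** α(b a) = α(b) α(a) = (b ⊗ 1) α(a) = b α(a) for coinvariant b. *)
Lemma coact_linear_coinv Z :
  α Z ∘ (μ Z ∘ on11 (coinv_i A) (A ⊗ Z))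
  = μ (H ⊗ Z) ∘ (A ◁ α Z) ∘ on11 (coinv_i A) (A ⊗ Z).
Proof.
rewrite (compr (coact_linear _)); slide.
rewrite coinv_coact_strands; slide.
by rewrite (compr (lw_eq _ (entwining_unit_coact _ _))).
Qed.

Lemma galois_map_balanced X :
  on21 (galois_map_lift X) 𝟙 ∘ on21 (rmod_act (restrict X)) (A ⊗ 𝟙)
  = on21 (galois_map_lift X) 𝟙 ∘ (X ◁ μ 𝟙)
    ∘ (X ◁ on11 (coinv_i A) (A ⊗ 𝟙)).
Proof.
apply: split_inj; slide; rewrite !(compr (galois_map_lift_strands _ _)).
rewrite restrict_strands; slide.
rewrite -!lw_comp coact_linear_coinv.
rewrite ?lw_comp ?compAr (compr (act_act (rmodP X) _)).
by slide.
Qed.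

Definition galois_map X : hom (T (restrict X)) (X ⊗ H) :=
  proj1_sig (tensA_desc_sig (galois_map_balanced X)).

Lemma galois_map_strands X Z :
  on12 (galois_map X) Z ∘ on21 (tensA_q (restrict X)) Z
  = on21 (rmod_act X) (H ⊗ Z) ∘ (X ◁ α Z).
Proof.
rewrite -(comp1f (galois_map X)) on12_comp compAr.
rewrite (proj2_sig (tensA_desc_sig (galois_map_balanced X))).
exact: galois_map_lift_strands.
Qed.

Lemma galois_map_linear X :
  is_rmod_mor (M := tensB_rmod (restrict X) (coinv_bimod A))
    (N := cofree_rmod X) (galois_map X).
Proof.
apply: rmod_mor_strands; apply: split_inj; apply: tensA_epi.
rewrite !compAr tensB_act_strands !(compr (split_on11 _ _)); slide.
rewrite (compr (galois_map_strands _ _)); slide.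
rewrite (compr (cofree_act_strands _ _)); slide.
rewrite (compr (split_on11 _ _)) galois_map_strands; slide.
rewrite (compr (act_act (rmodP X) _)); slide.
by rewrite (lw_eq _ (coact_linear _)); slide.
Qed.

Definition regular : rmod A := RMod (alg_rmodP A).

Lemma can_galois_map : can A = galois_map regular.
Proof.
apply: coequalizer_epi (coeqmP _ _) _ _ _ _.
rewrite [LHS](coeq_descE _ (can_subproof A)).
apply: on21_inj; apply: split_inj.
rewrite [on21 (_ ∘ _) _]on21_comp (compr (split_on11 _ _)).
rewrite [RHS](galois_map_strands regular 𝟙).
exact: (galois_map_lift_strands regular 𝟙).
Qed.

(** The map X ⊗ (A ⊗_B A) -> X ⊗_B A, x ⊗ (a ⊗ a') ↦ x a ⊗ a'.  It exists
because X ⊗ - preserves the coequalizer A ⊗_B A; for X = A it is the left action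
of A on A ⊗_B A. *)
Lemma act_desc_sig X :
  {k : hom (X ⊗ T (restrict regular)) (T (restrict X)) | forall Z,
    on21 k Z ∘ (X ◁ on21 (tensA_q (restrict regular)) Z)
    = on21 (tensA_q (restrict X)) Z ∘ on21 (rmod_act X) (A ⊗ Z)}.
Proof.
have C := tensl_coeq X (tensA_q_coequalizer (restrict regular)).
pose h : hom (X ⊗ (A ⊗ A)) (T (restrict X)) :=
  tensA_q (restrict X) ∘ (rmod_act X ⊠ idm A) ⊙ idm (X ⊗ (A ⊗ A)).
have hp : ⟦h⟧ = ⟦tensA_q (restrict X)⟧ • (⟦rmod_act X⟧ ⋆ ⟦idm A⟧).
  by rewrite pof_scomp pof_comp pof_ten pcompf1 //; obs.
(* x (a b) ⊗ a' = (x a) b ⊗ a' = x a ⊗ b a' for coinvariant b. *)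
have E : on21 (tensA_q (restrict X)) 𝟙 ∘ on21 (rmod_act X) (A ⊗ 𝟙)
    ∘ (X ◁ on21 (rmod_act (restrict regular)) (A ⊗ 𝟙))
    = on21 (tensA_q (restrict X)) 𝟙 ∘ on21 (rmod_act X) (A ⊗ 𝟙)
    ∘ (X ◁ A ◁ (μ 𝟙 ∘ on11 (coinv_i A) (A ⊗ 𝟙))).
  have R : on21 (rmod_act (restrict regular)) (A ⊗ 𝟙)
      = μ (A ⊗ 𝟙) ∘ (A ◁ on11 (coinv_i A) (A ⊗ 𝟙)).
    exact: (restrict_strands regular).
  have B := tensB_l_strands (restrict X) 𝟙.
  rewrite restrict_strands in B; move: B; slide => B.
  rewrite R; slide; rewrite (compr (eq_sym (act_act (rmodP X) _))); slide.
  rewrite -(nat21 (rmod_act X) (on11 (coinv_i A) (A ⊗ 𝟙))).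
  rewrite (compA (on21 (rmod_act X) _) (X ◁ _)).
  by rewrite (compA (on21 (tensA_q _) _) (_ ∘ (X ◁ on11 _ _))) B; slide.
have hP : h ∘ fmap (tensl X) (tensB_l (restrict regular) (coinv_bimod A))
    = h ∘ fmap (tensl X) (tensB_r (restrict regular) (coinv_bimod A)).
  apply: pof_inj; rewrite [LHS]pof_comp [RHS]pof_comp hp.
  move: E => /(f_equal pof); rewrite !pof_comp !pstrands !pof_comp !pstrands.
  rewrite !pof_id_ten !ptenf1 => E.
  rewrite [in RHS]pof_ten ptensB_r /= pof_comp pof_ten.
  rewrite (pof_ten (rmod_act (restrict regular))).
  rewrite [⟦rmod_act (restrict _)⟧]pof_comp.
  exact: E.
exists (coeq_desc C hP) => Z.
have kp : ⟦coeq_desc C hP⟧ • (⟦idm X⟧ ⋆ ⟦tensA_q (restrict regular)⟧)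
    = ⟦tensA_q (restrict X)⟧ • (⟦rmod_act X⟧ ⋆ ⟦idm A⟧).
  rewrite -pof_ten -pof_comp.
  exact: (eq_trans (f_equal pof (coeq_descE C hP)) hp).
apply: pof_inj; rewrite !pof_comp !pstrands !pof_id_ten !ptenA.
rewrite ptenCl; try obs.
rewrite ptenCl; try obs.
by rewrite kp.
Qed.

Definition act_desc X : hom (X ⊗ T (restrict regular)) (T (restrict X)) :=
  proj1_sig (act_desc_sig X).

Lemma act_desc_strands X Z :
  on21 (act_desc X) Z ∘ (X ◁ on21 (tensA_q (restrict regular)) Z)
  = on21 (tensA_q (restrict X)) Z ∘ on21 (rmod_act X) (A ⊗ Z).
Proof. exact: (proj2_sig (act_desc_sig X)). Qed.

Lemma galois_map_act_desc X Z :
  on12 (galois_map X) Z ∘ on21 (act_desc X) Z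
  = on21 (rmod_act X) (H ⊗ Z) ∘ (X ◁ on12 (galois_map regular) Z).
Proof.
apply: lw_tensA_epi; rewrite !compAr act_desc_strands.
rewrite (compr (galois_map_strands _ _)) (lw_eq _ (galois_map_strands _ _)).
slide.
by rewrite (compr (act_act (rmodP X) _)); slide.
Qed.

Lemma act_desc_act X Z :
  on21 (act_desc X) Z ∘ on21 (rmod_act X) (T (restrict regular) ⊗ Z)
  = on21 (act_desc X) Z ∘ (X ◁ on21 (act_desc regular) Z).
Proof.
apply: lw_lw_tensA_epi; rewrite !compAr -(nat21 (rmod_act X)).
rewrite (compr (act_desc_strands _ _)) (lw_eq X (act_desc_strands regular _)).
rewrite ?lw_comp (compr (act_desc_strands _ _)); slide.
by rewrite (act_act (rmodP X) _).
Qed.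

(** Given an inverse c of can, the inverse of the Galois map of X is
x ⊗ h ↦ x c(1 ⊗ h).  Verifying this uses that c is left A-linear and that
c(α(a)) = 1 ⊗ a, both of which follow by applying can. *)
Section GaloisIso.
Variable c : hom (A ⊗ H) (T (restrict regular)).
Hypothesis cK : c ∘ galois_map regular = idm (T (restrict regular)).
Hypothesis Kc : galois_map regular ∘ c = idm (A ⊗ H).

Lemma galois_map_regularK Z : on12 (galois_map regular) Z ∘ on21 c Z = idm _.
Proof. by rewrite on12_on21 Kc on22_1. Qed.

Lemma galois_map_regular_mono W Z (u v : hom W (T (restrict regular) ⊗ Z)) :
  on12 (galois_map regular) Z ∘ u = on12 (galois_map regular) Z ∘ v -> u = v.
Proof.
have K : on21 c Z ∘ on12 (galois_map regular) Z = idm _.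
  by rewrite on21_on12 cK on11_1.
by move=> E; rewrite -(comp1f u) -(comp1f v) -K !compAr E.
Qed.

Lemma galois_inv_coact Z :
  on21 c Z ∘ α Z
  = on21 (tensA_q (restrict regular)) Z ∘ on01 (alg_unit A) (A ⊗ Z).
Proof.
apply: galois_map_regular_mono.
rewrite (compr (galois_map_regularK _)) (compr (galois_map_strands _ _)); slide.
by rewrite comp1f (compr (mul_unitl _ _)) comp1f.
Qed.

Lemma galois_inv_linear Z :
  on21 (act_desc regular) Z ∘ (A ◁ (on21 c Z ∘ on01 (alg_unit A) (H ⊗ Z)))
  = on21 c Z.
Proof.
apply: galois_map_regular_mono; slide.
rewrite (compr (galois_map_act_desc _ _)); slide.
rewrite (compr (lw_eq _ (galois_map_regularK _))) lw1 comp1f.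
by rewrite [LHS]mul_unitr galois_map_regularK.
Qed.

Definition galois_map_inv X : hom (X ⊗ (H ⊗ 𝟙)) (T (restrict X) ⊗ 𝟙) :=
  on21 (act_desc X) 𝟙 ∘ (X ◁ on21 c 𝟙) ∘ (X ◁ on01 (alg_unit A) (H ⊗ 𝟙)).

Lemma galois_map_invKr X :
  on12 (galois_map X) 𝟙 ∘ galois_map_inv X = idm (X ⊗ (H ⊗ 𝟙)).
Proof.
rewrite /galois_map_inv; slide; rewrite (compr (galois_map_act_desc _ _)).
slide; rewrite (compr (lw_eq _ (galois_map_regularK _))) lw1 comp1f.
by rewrite (act_unit (rmodP X)).
Qed.

Lemma galois_map_invKl X :
  galois_map_inv X ∘ on12 (galois_map X) 𝟙 = idm (T (restrict X) ⊗ 𝟙).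
Proof.
apply: tensA_epi; rewrite /galois_map_inv !compAr galois_map_strands; slide.
rewrite (compr (act_desc_act _ _)); slide.
rewrite (compr (lw_eq X (eq_sym (lw_comp A (on21 c 𝟙) (on01 _ _))))).
rewrite (compr (lw_eq _ (galois_inv_linear _))) (lw_eq _ (galois_inv_coact _)).
rewrite lw_comp (compr (act_desc_strands _ _)) !compAr.
by rewrite (act_unit (rmodP X)) comp1f compf1.
Qed.

End GaloisIso.

Lemma is_iso_pof (C : category) (X Y X' Y' : C) (f : hom X Y) (f' : hom X' Y') :
  X = X' -> Y = Y' -> ⟦f⟧ = ⟦f'⟧ -> is_iso f -> is_iso f'.
Proof. by move=> eX eY; destruct eX, eY => /pof_inj ->. Qed.

Lemma galois_map_iso X : galois A -> is_iso (galois_map X).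
Proof.
rewrite /galois can_galois_map => [] [c [cK Kc]].
apply: (@is_iso_pof _ _ _ _ _ (on12 (galois_map X) 𝟙)); rewrite ?tenoI //.
  by rewrite pstrands ptenf1.
by exists (galois_map_inv c X); split;
  [exact: galois_map_invKl | exact: galois_map_invKr].
Qed.
End GaloisMap.

(** * Coinvariants of an entwined module *)
Section Coinvariants.
Variables (V : ambient) (H : bialgebra V) (A : comod_algebra H).
Implicit Types (M : rmod (coinv A)) (Z W : V).
Local Notation entmods := (entmod (C := bi_coalg H) (entwining A)).
Local Notation α := (on12 (ca_coact A)).
Local Notation μ := (on21 (alg_mul A)).
Local Notation λ := (on22 (entwining A)).
Local Notation η := (on01 (alg_unit H)).
Local Notation T M := (tensB M (coinv_bimod A)).
Local Notation iA := (on11 (coinv_i A)).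

Section OneModule.
Variable X : entmods.
Local Notation ν := (on12 (ecoact X)).
Local Notation ξ := (on21 (entmod_act X)).
Local Notation XA := (entmod_rmod X).

Local Notation unit_coact := (insr X (alg_unit H)).

(** X^H as an object of V; its B-module structure is [mcoinv] below. *)
Definition mcoinv_ob : V := eqo (ecoact X) unit_coact.
Definition mcoinv_i : hom mcoinv_ob X := eqm (ecoact X) unit_coact.

Lemma mcoinv_iP : is_equalizer (ecoact X) unit_coact mcoinv_i.
Proof. exact: eqmP. Qed.

Lemma mcoinv_i_mono : mono mcoinv_i.
Proof. by move=> W u v; exact: (equalizer_mono mcoinv_iP). Qed.

Lemma mcoinv_coact_strands Z :
  ν Z ∘ on11 mcoinv_i Z = (X ◁ η Z) ∘ on11 mcoinv_i Z.
Proof. by rewrite -insr_strands -!on12_comp (proj1 mcoinv_iP). Qed.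

Definition mcoinv_act_lift : hom (mcoinv_ob ⊗ coinv A) X :=
  entmod_act X ∘ (idm X ⊠ coinv_i A) ∘ (mcoinv_i ⊠ idm (coinv A)).

Lemma mcoinv_act_lift_strands Z :
  on21 mcoinv_act_lift Z = ξ Z ∘ (X ◁ iA Z) ∘ on11 mcoinv_i (coinv A ⊗ Z).
Proof. by rewrite /mcoinv_act_lift on21_tenl on21_tenr. Qed.

(** Since ν(x) = x ⊗ 1 for coinvariant x, and λ(1 ⊗ a) = α(a), compatibility
gives ν(x a) = x α(a). *)
Lemma act_mcoinv_coact Z :
  ν Z ∘ (ξ Z ∘ on11 mcoinv_i (A ⊗ Z))
  = ξ (H ⊗ Z) ∘ ((X ◁ α Z) ∘ on11 mcoinv_i (A ⊗ Z)).
Proof.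
rewrite (compr (ecoact_act _ _)); slide; rewrite mcoinv_coact_strands.
by rewrite (compr (lw_eq _ (entwining_unit_coact _ _))).
Qed.

Lemma mcoinv_act_subproof :
  ecoact X ∘ mcoinv_act_lift = unit_coact ∘ mcoinv_act_lift.
Proof.
apply: on22_inj; rewrite -!on12_on21 mcoinv_act_lift_strands insr_strands.
slide; rewrite (compr (ecoact_act _ _)); slide.
rewrite (nat11 mcoinv_i) (compr (mcoinv_coact_strands _)); slide.
rewrite (compr (lw_eq _ (entwining_unit_coact _ _))).
by rewrite (compr (lw_eq _ (coinv_coact_strands _ _))); slide.
Qed.

Definition mcoinv_act : hom (mcoinv_ob ⊗ coinv A) mcoinv_ob :=
  eq_lift mcoinv_iP mcoinv_act_subproof.

Lemma mcoinv_act_strands Z :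
  on11 mcoinv_i Z ∘ on21 mcoinv_act Z
  = ξ Z ∘ (X ◁ iA Z) ∘ on11 mcoinv_i (coinv A ⊗ Z).
Proof. by rewrite -mcoinv_act_lift_strands -on21_comp /mcoinv_act eq_liftE. Qed.

Lemma mcoinv_rmodP : is_rmod mcoinv_act.
Proof.
apply: is_rmod_strands; apply: (on11_unit_mono mcoinv_i_mono).
- rewrite !(compr (mcoinv_act_strands _)); slide.
  rewrite mcoinv_act_strands; slide.
  rewrite (compr (act_act (entmod_rmodP X) _)); slide.
  by rewrite (compr (lw_eq _ (coinv_mul_strands _ _))); slide.
- rewrite (compr (mcoinv_act_strands _)); slide.
  rewrite (compr (lw_eq _ (coinv_unit_strands _ _))).
  by rewrite (compr (act_unit (entmod_rmodP X) _)) comp1f compf1.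
Qed.

Definition mcoinv : rmod (coinv A) := RMod mcoinv_rmodP.

Lemma counit_subproof :
  on21 (entmod_act X ∘ (mcoinv_i ⊠ idm A)) 𝟙 ∘ on21 (rmod_act mcoinv) (A ⊗ 𝟙)
  = on21 (entmod_act X ∘ (mcoinv_i ⊠ idm A)) 𝟙 ∘ (mcoinv ◁ μ 𝟙)
    ∘ (mcoinv ◁ iA (A ⊗ 𝟙)).
Proof.
rewrite on21_tenl; slide; rewrite mcoinv_act_strands; slide.
by rewrite (compr (act_act (entmod_rmodP X) _)); slide.
Qed.

Definition mcoinv_counit : hom (T mcoinv) X :=
  proj1_sig (tensA_desc_sig counit_subproof).

Lemma mcoinv_counit_strands Z :
  on11 mcoinv_counit Z ∘ on21 (tensA_q mcoinv) Z = ξ Z ∘ on11 mcoinv_i (A ⊗ Z).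
Proof. by rewrite (proj2_sig (tensA_desc_sig counit_subproof)) on21_tenl. Qed.

Lemma mcoinv_counit_mor :
  is_entmod_mor (X := Fbar_ob mcoinv) (Y := X) mcoinv_counit.
Proof.
split.
- apply: (@rmod_mor_strands _ _ (entmod_rmod (Fbar_ob mcoinv)) XA).
  apply: tensA_epi; rewrite !compAr tensB_act_strands.
  rewrite (compr (mcoinv_counit_strands _)); slide.
  rewrite mcoinv_counit_strands; slide.
  by rewrite (compr (act_act (entmod_rmodP X) _)); slide.
- apply: comod_mor_strands; apply: tensA_epi.
  rewrite !compAr Fbar_coact_strands mcoinv_counit_strands.
  rewrite (compr (mcoinv_counit_strands _)); slide.
  exact: act_mcoinv_coact.
Qed.

(** The B-linear map M -> X^H that corresponds to phi sends m to phi (m ⊗ 1). *)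
Section Transpose.
Variables (M : rmod (coinv A)) (phi : hom (T M) X).
Hypothesis phi_mor : is_entmod_mor (X := Fbar_ob M) (Y := X) phi.

Definition transpose_lift : hom M X := phi ∘ (tensA_q M ∘ insr M (alg_unit A)).

Lemma transpose_lift_strands Z :
  on11 transpose_lift Z
  = on11 phi Z ∘ on21 (tensA_q M) Z ∘ (M ◁ on01 (alg_unit A) Z).
Proof. by rewrite /transpose_lift on11_comp -on21_on12 insr_strands compA. Qed.

Lemma phi_coact Z :
  on12 (ecoact X) Z ∘ on11 phi Z = on11 phi (H ⊗ Z) ∘ on12 (Fbar_coact M) Z.
Proof. exact: (mor_ecoact phi_mor). Qed.

Lemma phi_act Z :
  on11 phi Z ∘ on21 (tensB_act M (coinv_bimod A)) Z = ξ Z ∘ on11 phi (A ⊗ Z).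
Proof. exact: (mor_eact phi_mor). Qed.

Lemma transpose_subproof :
  ecoact X ∘ transpose_lift = unit_coact ∘ transpose_lift.
Proof.
apply: on12_inj; rewrite on12_comp [in RHS]on12_comp.
rewrite transpose_lift_strands insr_strands.
slide; rewrite (compr (phi_coact _)); slide.
rewrite (compr (Fbar_coact_strands _ _)); slide.
rewrite (lw_eq _ (coact_unit _ _)).
rewrite (compr (nat11 phi _)) !compAr (compr (nat21 (tensA_q M) _)) !compAr.
by rewrite (lw_eq _ (nat01 _ _)).
Qed.

Definition transpose_map : hom M mcoinv_ob :=
  eq_lift mcoinv_iP transpose_subproof.

Lemma transpose_map_strands Z :
  on11 mcoinv_i Z ∘ on11 transpose_map Z
  = on11 phi Z ∘ on21 (tensA_q M) Z ∘ (M ◁ on01 (alg_unit A) Z).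
Proof. by rewrite -transpose_lift_strands -on11_comp [_ ∘ _]eq_liftE. Qed.

Lemma transpose_map_mor : is_rmod_mor (M := M) (N := mcoinv) transpose_map.
Proof.
apply: rmod_mor_strands; apply: (on11_unit_mono mcoinv_i_mono).
rewrite (compr (transpose_map_strands _)).
rewrite [in RHS](compr (mcoinv_act_strands _)); slide.
rewrite [in RHS]transpose_map_strands !compAr.
rewrite (compr (nat11 phi _)) !compAr (compr (nat21 (tensA_q M) _)) !compAr.
rewrite (lw_eq _ (nat01 _ _)) (compr (eq_sym (phi_act _))) !compAr.
rewrite (compr (tensB_act_strands _ _)) (compr (tensB_l_strands _ _)); slide.
by rewrite (compr (lw_eq _ (mul_unitl _ _))) (compr (lw_eq _ (mul_unitr _ _))).
Qed.

Lemma counit_transpose :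
  mcoinv_counit ∘ tensB_map (coinv_bimod A)
    (exist _ transpose_map transpose_map_mor : rmod_hom M mcoinv) = phi.
Proof.
apply: on11_inj; rewrite on11_comp; apply: tensA_epi.
rewrite !compAr tensB_map_strands (compr (mcoinv_counit_strands _)) !compAr.
rewrite transpose_map_strands !compAr.
rewrite (compr (eq_sym (phi_act _))) !compAr (compr (tensB_act_strands _ _)).
by rewrite !compAr (lw_eq _ (mul_unitl _ _)) lw1 compf1.
Qed.
End Transpose.

Lemma counit_map_unit M (f : rmod_hom M mcoinv) Z :
  on11 (mcoinv_counit ∘ tensB_map (coinv_bimod A) f) Z ∘ on21 (tensA_q M) Z
    ∘ (M ◁ on01 (alg_unit A) Z)
  = on11 mcoinv_i Z ∘ on11 (proj1_sig f) Z.
Proof.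
rewrite on11_comp !compAr (compr (tensB_map_strands _ _)) !compAr.
rewrite (compr (mcoinv_counit_strands _)) !compAr -(nat11 (proj1_sig f)).
rewrite (compr (eq_sym (nat11 mcoinv_i _))) !compAr.
by rewrite (compr (act_unit (entmod_rmodP X) _)) comp1f.
Qed.

Definition mcoinv_counit_hom : entmod_hom (Fbar_ob mcoinv) X :=
  exist _ mcoinv_counit mcoinv_counit_mor.

Lemma mcoinv_counit_universal :
  @universal_arrow _ _ (Fbar A) X mcoinv mcoinv_counit_hom.
Proof.
move=> M h.
exists (exist _ (transpose_map (proj2_sig h))
  (transpose_map_mor (proj2_sig h))).
split=> [|f fh]; first by apply: sig_eqP; exact: counit_transpose.
apply: sig_eqP; apply: mcoinv_i_mono; apply: on11_inj.
rewrite !on11_comp transpose_map_strands -counit_map_unit.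
by rewrite [mcoinv_counit ∘ _](f_equal (@proj1_sig _ _) fh).
Qed.
End OneModule.
End Coinvariants.

(** * The structure theorem *)
Section StructureTheorem.
Variables (V : ambient) (H : bialgebra V) (A : comod_algebra H).
Implicit Types (M : rmod (coinv A)) (Z W : V).
Local Notation entmods := (entmod (C := bi_coalg H) (entwining A)).
Local Notation entcat := (@entmod_cat V (bi_coalg H) A (entwining A)).
Local Notation α := (on12 (ca_coact A)).
Local Notation μ := (on21 (alg_mul A)).
Local Notation λ := (on22 (entwining A)).
Local Notation T M := (tensB M (coinv_bimod A)).
Local Notation induction := (tensB_functor (coinv_bimod A)).

Lemma restrict_mor (X Y : rmod A) (f : hom X Y) :
  is_rmod_mor (M := X) (N := Y) f ->
  is_rmod_mor (M := restrict X) (N := restrict Y) f.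
Proof.
move=> P; apply: rmod_mor_strands; rewrite !restrict_strands; slide.
rewrite (compr (mor_act P _)) !compAr.
by rewrite (nat11 f).
Qed.

Section Counit.
Variable X : entmods.
Local Notation XA := (entmod_rmod X).
Local Notation ν := (on12 (ecoact X)).

Lemma ecoact_linear : is_rmod_mor (M := XA) (N := cofree_rmod XA) (ecoact X).
Proof.
apply: rmod_mor_strands; apply: split_inj.
rewrite (compr (split_on11 _ _)) ecoact_act.
by rewrite (compr (cofree_act_strands _ _)) !compAr split_on11.
Qed.

(** The map x ↦ x ⊗ 1 is B-linear because α(b) = b ⊗ 1 for coinvariant b. *)
Lemma insr_linear :
  is_rmod_mor (M := restrict XA) (N := restrict (cofree_rmod XA))
    (insr X (alg_unit H)).
Proof.
apply: rmod_mor_strands; apply: split_inj.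
rewrite !restrict_strands; slide.
rewrite !(compr (split_on11 _ _)) insr_strands.
rewrite (compr (cofree_act_strands XA _)); slide.
rewrite split_on11 insr_strands; slide.
rewrite (compr (lw_eq _ (entwining_unit_coact _ _))).
by rewrite (lw_eq _ (coinv_coact_strands _ _)); slide.
Qed.

Definition coact_hom : rmod_hom (restrict XA) (restrict (cofree_rmod XA)) :=
  exist _ (ecoact X) (restrict_mor ecoact_linear).
Definition unit_hom : rmod_hom (restrict XA) (restrict (cofree_rmod XA)) :=
  exist _ (insr X (alg_unit H)) insr_linear.

Lemma mcoinv_i_linear :
  is_rmod_mor (M := mcoinv X) (N := restrict XA) (mcoinv_i X).
Proof.
apply: rmod_mor_strands; rewrite restrict_strands.
exact: mcoinv_act_strands.
Qed.

Definition mcoinv_i_hom : rmod_hom (mcoinv X) (restrict XA) :=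
  exist _ (mcoinv_i X) mcoinv_i_linear.

Lemma mcoinv_equalizer :
  @is_equalizer (rmod_cat (coinv A)) _ _ _ coact_hom unit_hom mcoinv_i_hom.
Proof. by apply: rmod_equalizer; exact: mcoinv_iP. Qed.

Lemma galois_map_mcoinv_i :
  galois_map XA ∘ tensB_map (coinv_bimod A) mcoinv_i_hom
  = ecoact X ∘ mcoinv_counit X.
Proof.
apply: on12_inj; rewrite !on12_comp; apply: tensA_epi.
rewrite !compAr tensB_map_strands mcoinv_counit_strands.
by rewrite (compr (galois_map_strands _ _)) !compAr act_mcoinv_coact.
Qed.

(** The two maps X ⊗_B A -> (X ⊗ H) ⊗_B A induced by ν and by x ↦ x ⊗ 1 become
ν ⊗ H and X ⊗ δ under the Galois maps of X and of X ⊗ H. *)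
Lemma galois_map_coact_hom Z :
  on12 (idm (X ⊗ H)) (H ⊗ Z) ∘ (on12 (galois_map (cofree_rmod XA)) Z
    ∘ on11 (tensB_map (coinv_bimod A) coact_hom) Z)
  = ν (H ⊗ Z) ∘ on12 (galois_map XA) Z.
Proof.
apply: tensA_epi; rewrite !compAr tensB_map_strands galois_map_strands.
rewrite (compr (galois_map_strands _ _)); slide.
rewrite (compr (cofree_act_strands XA _)) (compr (ecoact_act _ _)); slide.
by rewrite split_on11 (nat12 (ecoact X)).
Qed.

Lemma galois_map_unit_hom Z :
  on12 (idm (X ⊗ H)) (H ⊗ Z) ∘ (on12 (galois_map (cofree_rmod XA)) Z
    ∘ on11 (tensB_map (coinv_bimod A) unit_hom) Z)
  = (X ◁ on12 (bi_comul H) Z) ∘ on12 (galois_map XA) Z.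
Proof.
apply: tensA_epi; rewrite !compAr tensB_map_strands galois_map_strands.
rewrite (compr (galois_map_strands _ _)); slide.
rewrite (compr (cofree_act_strands XA _)); slide.
rewrite split_on11 insr_strands. slide.
rewrite (compr (lw_eq _ (entwining_unit_coact _ _))).
by rewrite (lw_eq _ (ca_coact_coact A _)); slide.
Qed.

Lemma ecoact_mono : mono (ecoact X).
Proof.
move=> W u v E; apply: on11_inj.
rewrite -(comp1f (on11 u _)) -(comp1f (on11 v _)).
by rewrite -(coact_counit (ecoactP X)) !compAr -!on12_comp E.
Qed.

(** The transport of ν along the Galois map equalizes the induced pair, because
ν is coassociative. *)
Lemma ecoact_descent (k : hom X (T (restrict XA))) :
  galois A -> galois_map XA ∘ k = ecoact X ->
  tensB_map (coinv_bimod A) coact_hom ∘ k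
  = tensB_map (coinv_bimod A) unit_hom ∘ k.
Proof.
move=> A_galois kE.
apply: (iso_mono (galois_map_iso (cofree_rmod XA) A_galois)).
have kS Z : on12 (galois_map XA) Z ∘ on11 k Z = ν Z by rewrite -on12_comp kE.
apply: on12_inj; rewrite !on12_comp !on11_comp; apply: split_inj.
rewrite !(compA _ (on11 (tensB_map _ _) _)) !(compA (on12 (idm _) _) (_ ∘ _)).
rewrite galois_map_coact_hom galois_map_unit_hom !compAr kS.
exact: coact_coact (ecoactP X) 𝟙.
Qed.

(** The induced map X^H ⊗_B A -> X ⊗_B A is an equalizer, and the inverse image
of ν under the Galois map factors through it.  The factorization is inverse to
the counit by [galois_map_mcoinv_i]. *)
Lemma mcoinv_counit_iso :
  galois A -> preserves_equalizers induction ->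
  is_iso (C := entcat) (mcoinv_counit_hom X).
Proof.
move=> A_galois ind_eq; apply: forget_coact_conservative.
have F_eq := ind_eq _ _ _ _ _ _ mcoinv_equalizer.
have [g [gK Kg]] := galois_map_iso XA A_galois.
have g_linear : is_rmod_mor (M := cofree_rmod XA)
    (N := tensB_rmod (restrict XA) (coinv_bimod A)) g.
  have /= lin := galois_map_linear XA.
  rewrite /is_rmod_mor /= -[LHS]compf1 -tenm1 -[idm (X ⊗ H)]Kg.
  by rewrite tensr_subproof2 compA -(compA g) -lin compA gK comp1f.
have h_linear : is_rmod_mor (M := XA)
    (N := tensB_rmod (restrict XA) (coinv_bimod A)) (g ∘ ecoact X).
  exact: (rmod_mor_comp (N := cofree_rmod XA)) g_linear ecoact_linear.
pose h : hom (c := rmod_cat A) XA (induction (restrict XA)) :=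
  exist _ (g ∘ ecoact X) h_linear.
have hE : galois_map XA ∘ (g ∘ ecoact X) = ecoact X.
  by rewrite compA Kg comp1f.
have h_eq : fmap induction coact_hom ∘ h = fmap induction unit_hom ∘ h.
  by apply: sig_eqP; exact: ecoact_descent A_galois hE.
have [u [uh _]] := proj2 F_eq XA h h_eq.
have uh0 : tensB_map (coinv_bimod A) mcoinv_i_hom ∘ proj1_sig u = g ∘ ecoact X.
  exact: (f_equal (@proj1_sig _ _) uh).
exists u; split; last first.
  apply: sig_eqP; apply: ecoact_mono; rewrite /= compA compf1.
  by rewrite -galois_map_mcoinv_i -compA uh0.
apply: (equalizer_mono F_eq); rewrite compA uh compf1; apply: sig_eqP.
rewrite /= -[RHS]comp1f -gK -!compA; congr (_ ∘ _).
by rewrite -[LHS]galois_map_mcoinv_i.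
Qed.
End Counit.

Lemma induction_forget M M' (f : hom (c := rmod_cat (coinv A)) M M') :
  fmap induction f = fmap (forget_coact A) (fmap (Fbar A) f).
Proof. exact: sig_eqP. Qed.

Lemma equivalence_of_galois :
  galois A -> left_faithfully_flat (coinv_bimod A) -> is_equivalence (Fbar A).
Proof.
move=> A_galois [ind_eq ind_cons].
refine (@equivalence_of_counit _ _ (Fbar A) (@mcoinv V H A)
  (@mcoinv_counit_hom V H A) _ _ _).
- by move=> X; exact: mcoinv_counit_universal.
- by move=> X; exact: mcoinv_counit_iso.
- move=> M M' f f_iso; apply: ind_cons; rewrite induction_forget.
  exact: (@fmap_iso _ _ (forget_coact A) _ _ _ f_iso).
Qed.

Lemma faithfully_flat_of_equivalence :
  flat (bi_alg H : V) -> is_equivalence (Fbar A) ->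
  left_faithfully_flat (coinv_bimod A).
Proof.
move=> H_flat E; split.
- move=> X Y K f g e P; rewrite !induction_forget.
  exact: (forget_coact_equalizers H_flat (equivalence_equalizers E P)).
- move=> M M' f; rewrite induction_forget => f_iso.
  apply: (equivalence_conservative E).
  exact: (@forget_coact_conservative _ _ _ (Fbar A M) (Fbar A M') _ f_iso).
Qed.

Section CofreeUniversal.
Variable X : rmod A.
Local Notation ξ := (on21 (rmod_act X)).
Local Notation η := (on01 (alg_unit A)).
Local Notation ε := (on10 (bi_counit H)).

Lemma galois_map_mor :
  is_entmod_mor (X := Fbar_ob (restrict X)) (Y := cofree X) (galois_map X).
Proof.
split; first exact: galois_map_linear.
apply: comod_mor_strands; apply: split_inj; apply: tensA_epi.
rewrite !compAr Fbar_coact_strands (compr (cofree_coact_strands _ _)).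
rewrite !(compr (split_on11 _ _)) !compAr (compr (split_on11 _ _)).
rewrite galois_map_strands (compr (galois_map_strands _ _)); slide.
by rewrite (lw_eq _ (ca_coact_coact A _)); slide.
Qed.

Definition galois_map_hom : entmod_hom (Fbar_ob (restrict X)) (cofree X) :=
  exist _ (galois_map X) galois_map_mor.

(** The B-linear map M -> X that corresponds to phi sends m to
(X ⊗ ε)(phi (m ⊗ 1)); phi is recovered from it by linearity and colinearity. *)
Section Factor.
Variables (M : rmod (coinv A)) (phi : hom (T M) (X ⊗ H)).
Hypothesis phi_mor : is_entmod_mor (X := Fbar_ob M) (Y := cofree X) phi.

Definition factor : hom M X :=
  delr X (bi_counit H) ∘ (phi ∘ (tensA_q M ∘ insr M (alg_unit A))).

Lemma factor_strands Z :
  on11 factor Z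
  = (X ◁ ε Z) ∘ on12 phi Z ∘ on21 (tensA_q M) Z ∘ (M ◁ η Z).
Proof.
rewrite /factor -on21_on12 delr_strands !compAr; congr (_ ∘ _).
by rewrite on12_comp -on21_on12 insr_strands compA.
Qed.

Lemma counit_phi_act Z :
  (X ◁ ε Z) ∘ (on12 phi Z ∘ on21 (tensB_act M (coinv_bimod A)) Z)
  = ξ Z ∘ ((X ◁ ε (A ⊗ Z)) ∘ on12 phi (A ⊗ Z)).
Proof.
have E : on11 phi Z ∘ on21 (tensB_act M (coinv_bimod A)) Z
    = on21 (cofree_act X) Z ∘ on11 phi (A ⊗ Z) := mor_eact phi_mor Z.
rewrite -split_on11 compAr E (compr (cofree_act_strands _ _)); slide.
rewrite split_on11.
by rewrite (compr (lw_eq _ (entwining_counit _ _))).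
Qed.

Lemma phi_Fbar_coact Z :
  on12 phi (H ⊗ Z) ∘ on12 (Fbar_coact M) Z
  = (X ◁ on12 (bi_comul H) Z) ∘ on12 phi Z.
Proof.
have E : on12 (cofree_coact X) Z ∘ on11 phi Z
    = on11 phi (H ⊗ Z) ∘ on12 (Fbar_coact M) Z := mor_ecoact phi_mor Z.
rewrite -split_on11 compAr -E (compr (cofree_coact_strands _ _)) !compAr.
by rewrite split_on11.
Qed.

Lemma factor_linear : is_rmod_mor (M := M) (N := restrict X) factor.
Proof.
apply: rmod_mor_strands; rewrite restrict_strands !factor_strands; slide.
rewrite (compr (tensB_l_strands _ _)); slide.
rewrite (compr (lw_eq _ (mul_unitr _ _))).
rewrite (compA (X ◁ ε _) (on12 phi _)) (compr (eq_sym (counit_phi_act _))).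
rewrite !compAr (compr (tensB_act_strands _ _)) !compAr.
by rewrite (compr (lw_eq _ (mul_unitl _ _))); slide.
Qed.

Lemma galois_map_factor :
  galois_map X ∘ tensB_map (coinv_bimod A)
    (exist _ factor factor_linear : rmod_hom M (restrict X)) = phi.
Proof.
apply: on12_inj; rewrite on12_comp; apply: tensA_epi.
rewrite !compAr tensB_map_strands (compr (galois_map_strands _ _)) !compAr.
rewrite factor_strands; slide.
rewrite (compA (X ◁ ε _) (on12 phi _)) (compr (eq_sym (counit_phi_act _))).
rewrite !compAr (compr (tensB_act_strands _ _)) !compAr.
rewrite (compr (lw_eq _ (mul_unitl _ _))) lw1 comp1f -Fbar_coact_strands.
rewrite (compr (phi_Fbar_coact _)) !compAr.
by rewrite (compr (lw_eq _ (comul_counitl _ _))) lw1 comp1f.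
Qed.
End Factor.

Lemma counit_galois_map M (f : rmod_hom M (restrict X)) Z :
  (X ◁ ε Z) ∘ on12 (galois_map X ∘ tensB_map (coinv_bimod A) f) Z
    ∘ on21 (tensA_q M) Z ∘ (M ◁ η Z)
  = on11 (proj1_sig f) Z.
Proof.
rewrite on12_comp !compAr (compr (tensB_map_strands _ _)) !compAr.
rewrite (compr (galois_map_strands _ _)) -(nat11 (proj1_sig f)); slide.
rewrite (compr (lw_eq _ (ca_coact_counit A _))) lw1 comp1f.
by rewrite (compr (act_unit (rmodP X) _)) comp1f.
Qed.

Lemma galois_map_universal :
  @universal_arrow _ _ (Fbar A) (cofree X) (restrict X) galois_map_hom.
Proof.
move=> M h.
exists (exist _ (factor (proj1_sig h)) (factor_linear (proj2_sig h))).
split=> [|f fh]; first by apply: sig_eqP; exact: galois_map_factor.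
apply: sig_eqP; apply: on11_inj; rewrite factor_strands -counit_galois_map.
by rewrite [galois_map X ∘ _](f_equal (@proj1_sig _ _) fh).
Qed.
End CofreeUniversal.

(** can is the Galois map of A, and an equivalence makes universal arrows
invertible. *)
Lemma galois_of_equivalence : is_equivalence (Fbar A) -> galois A.
Proof.
move=> E; rewrite /galois can_galois_map.
have [g [gK Kg]] :=
  equivalence_universal_iso E (galois_map_universal (X := regular A)).
exists (proj1_sig g); split.
- exact: (f_equal (@proj1_sig _ _) gK).
- exact: (f_equal (@proj1_sig _ _) Kg).
Qed.
End StructureTheorem.

Theorem theorem5p13 (V : ambient) (H : bialgebra V) (A : comod_algebra H)
    (H_flat : flat (bi_alg H : V)) :
  is_equivalence (Fbar A) <->
  galois A /\ left_faithfully_flat (coinv_bimod A).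
Proof.
split=> [E|[A_galois A_ff]]; last exact: equivalence_of_galois.
split; first exact: galois_of_equivalence.
exact: faithfully_flat_of_equivalence.
Qed.
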